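(* Let $X$ be an analytic subset of a complete separable metric space (with the induced metric), let $Y$ be a separable metric space, let $(\Lambda,\mathcal P)$ be a probability space, and let $\pi:\Lambda\times X\to Y$ be a measurable function; write $\pi_\lambda(\cdot)=\pi(\lambda,\cdot)$. Suppose there are positive real numbers $\alpha,\kappa,C$ such that $$\mathcal P\big[\lambda\in\Lambda:\ d(\pi_\lambda(x_1),\pi_\lambda(x_2))\le \delta\, d(x_1,x_2)^\alpha\big]\le C\delta^\kappa$$ for all $\delta>0$ and all $x_1,x_2\in X$ with $x_1\neq x_2$. Suppose $\dim X>\alpha\kappa$, and let $\eta$ be a measure on $Y$. (i) If $\eta$ is $\kappa$-regular, then $\eta(\pi_\lambda(X))>0$ for $\mathcal P$-a.e. $\lambda\in\Lambda$. (ii) If $\eta$ is strongly $\kappa$-regular and $\sigma$-finite, then $\int_\Lambda \eta(\pi_\lambda(X))^{-1}\,d\mathcal P(\lambda)<+\infty$.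
   Context: $\dim$ denotes Hausdorff dimension, $\dim X=\sup\{s\ge 0:\mathcal H^s(X)>0\}$ (possibly $+\infty$), where $\mathcal H^s$ is the $s$-dimensional Hausdorff measure. Measurability of $\pi$ is with respect to the product of the $\sigma$-algebra of $\Lambda$ with the Borel $\sigma$-algebra of $X$, and the Borel $\sigma$-algebra of $Y$. ''For a.e. $\lambda$'' means for all $\lambda$ outside some $\mathcal P$-null set. The letter $d$ denotes the metric on $X$ or $Y$, and $B(y,r)$ is the closed ball of center $y$ and radius $r$. A measure $\eta$ on $Y$ is called $\kappa$-regular if it is a Borel measure, it is upper regular by open sets (i.e. $\eta(A)=\inf\{\eta(U): U\supset A,\ U \text{ open}\}$ for every $A$), and $\liminf_{r\to0}\eta(B(y,r))/r^\kappa>0$ for all $y\in Y$. It is called strongly $\kappa$-regular if, in addition, this lower limit is uniformly positive: there is $c>0$ with $\liminf_{r\to0}\eta(B(y,r))/r^\kappa\ge c$ for all $y\in Y$. Conventions: for a set $A$ that is not Borel, $\eta(A)$ means the outer measure $\inf\{\eta(B): B\supset A,\ B\text{ Borel}\}$; $1/0=+\infty$, $1/(+\infty)=0$; if the integrand in (ii) is not measurable, the integral is understood as the upper integral, i.e. the claim is that the integrand is bounded above by a $\mathcal P$-integrable function. *)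

(* Defs.v *)
From HB Require Import structures.
From mathcomp Require Import all_boot all_order all_algebra.
From mathcomp Require Import all_classical all_reals all_analysis.
From mathcomp Require Import measurable_realfun.

Set Implicit Arguments.
Unset Strict Implicit.
Unset Printing Implicit Defensive.

Import Order.TTheory GRing.Theory Num.Theory.
Import numFieldNormedType.Exports.

Local Open Scope classical_set_scope.
Local Open Scope ring_scope.
Local Open Scope ereal_scope.

#[short(type="pointedMetricType")]
HB.structure Definition PointedMetric (R : numDomainType) :=
  {T of Metric R T & isPointed T}.

#[short(type="completeMetricType")]
HB.structure Definition CompleteMetric (R : numDomainType) :=
  {T of Metric R T & Complete T}.

Definition separable (T : topologicalType) : Prop :=
  exists2 D : set T, countable D & dense D.

(* Complete metric types are pointed, so the empty set needs its own case. *)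
Definition analytic (R : realType) (T : topologicalType) (A : set T) : Prop :=
  A = set0 \/
  exists S : completeMetricType R, separable S /\
    exists2 f : S -> T, continuous f & A = range f.

Section hausdorff.
Context {R : realType} {T : metricType R}.
Implicit Types (A E : set T) (s delta : R).

Definition diameter E : \bar R :=
  ereal_sup [set (mdist x y)%:E | x in E & y in E].

(* diam(E)^s with 0^0 = 1 but with weight 0 for the empty set (whose
   [diameter] is -oo); this makes the 0-dimensional measure the counting
   measure. *)
Definition hausdorff_weight s E : \bar R :=
  if E == set0 then 0 else diameter E `^ s.

Definition hausdorff_content s delta A : \bar R :=
  ereal_inf [set \sum_(0 <= i <oo) hausdorff_weight s (E i) |
    E in [set E : (set T)^nat |
      A `<=` \bigcup_i E i /\ forall i, diameter (E i) <= delta%:E]].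

(* [hausdorff_content] is nonincreasing in delta, so the limit as delta tends
   to 0 is a supremum. *)
Definition hausdorff_measure s A : \bar R :=
  ereal_sup [set hausdorff_content s delta A | delta in [set e : R | (0 < e)%R]].

Definition hausdorff_dim A : \bar R :=
  ereal_sup [set s%:E | s in [set s : R | (0 <= s)%R /\ 0 < hausdorff_measure s A]].

End hausdorff.

Definition borel (T : topologicalType) : set (set T) := <<s (@open T) >>.

(* Measurability of (l, x) |-> f l x. The product sigma-algebra is written out
   because the library's instance on L * X requires X to be pointed. *)
Definition jointly_measurable d (L : measurableType d) (X Y : topologicalType)
    (f : L -> X -> Y) : Prop :=
  forall B : set Y, borel B ->
    <<s [set A `*` U | A in @measurable d L & U in @borel X] >>
      [set lx : L * X | B (f lx.1 lx.2)].

Section regularity.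
Context {R : realType} {Y : pointedMetricType R}.
Variable eta : {measure set (g_sigma_algebraType (@open Y)) -> \bar R}.

Definition borel_outer (A : set Y) : \bar R :=
  ereal_inf [set eta B | B in [set B : set Y | borel B /\ A `<=` B]].

(* The library's [closed_ball] is the closure of the open ball, which can be
   smaller than this set. *)
Definition cball (y : Y) (r : R) : set Y := [set z | (mdist y z <= r)%R].

Definition lower_density (kappa : R) (y : Y) : \bar R :=
  limf_einf (fun r : R => eta (cball y r) / (r `^ kappa)%:E) (0%R^'+).

Definition regular_measure (kappa : R) : Prop :=
  (forall A : set Y, borel_outer A =
     ereal_inf [set eta U | U in [set U : set Y | open U /\ A `<=` U]]) /\
  (forall y : Y, 0 < lower_density kappa y).

Definition strongly_regular_measure (kappa : R) : Prop :=
  regular_measure kappa /\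
  exists2 c : R, (0 < c)%R & forall y : Y, c%:E <= lower_density kappa y.

End regularity.

(* Only meaningful for f >= 0; agrees with the integral when f is moreover
   measurable. *)
Definition upper_integral d (L : measurableType d) (R : realType)
    (mu : {measure set L -> \bar R}) (f : L -> \bar R) : \bar R :=
  ereal_inf [set \int[mu]_l g l | g in [set g : L -> \bar R |
    measurable_fun [set: L] g /\ forall l, f l <= g l]].

(* Main.v *)
(* Let s = alpha kappa. If [X] carries a probability law with finite s-energy
   E [d(x, x') ^ (- s)] < oo, then transversality, Fubini and Fatou show that for
   almost every l the projected law has finite lower kappa-density at most of its
   points, and a Vitali covering argument compares it with [eta], which bounds
   eta(proj_l X) from below.

   Such a law exists although [X] has no doubling structure. Choose points
   x_0, x_1, ... greedily, each one nearly minimizing the potential of its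
   predecessors: if at some stage the potential of the empirical measure were
   large on all of [X], a Vitali covering by balls of large mass would show that
   [X] has small Hausdorff content. Hence the empirical measures have bounded
   energy, and the law is a limit of them. To keep the limit inside the analytic
   set X = f(S), the points are confined to images of sets decreasing to a compact
   subset of S; this rests on a capacity that is exactly continuous along
   increasing unions, namely the least mass of a generalized measure whose
   potential is at least 1 off a null set. Exactness is possible because there is
   room between s and dim X. *)
Require Import Defs.
From HB Require Import structures.
From mathcomp Require Import all_boot all_order all_algebra.
From mathcomp Require Import all_classical all_reals all_analysis.
From mathcomp Require Import measurable_realfun.
From mathcomp Require Import ring lra zify.

Set Implicit Arguments.
Unset Strict Implicit.
Unset Printing Implicit Defensive.

Import Order.TTheory GRing.Theory Num.Theory.
Import numFieldNormedType.Exports.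

Local Open Scope classical_set_scope.
Local Open Scope ring_scope.

(** * Coverings *)

(** Three exponents s < s1 < s2, where X has positive s2-dimensional measure, enter through [a] =
    2^s, [q] = 2^-s1 and [q'] = 2^-s2. Since a q < 1, the fine-scale tail of a potential is
    geometrically small unless some single term is large; since q' < q, points where terms of size
    q^j recur at infinitely many scales form a null set. The obstacle is compactness: mass may
    escape in limits of measures on Z. Measures are therefore replaced by functionals u j x
    recording smoothed masses of balls, which survive pointwise limits. The capacity must lose
    nothing in such limits because the confinement to a compact set cuts the set down once at each
    of infinitely many levels, always for the same constant c. The limit of the empirical measures
    is at first only a finitely additive density along an ultrafilter. Tightness at every level
    allows nested subintervals of [0, 1) to code it, and Lebesgue measure then supplies countable
    additivity. *)

Lemma vitali_disjoint (I T : Type) (F : I -> set T) (j : I -> nat) (D : set I) :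
  (forall i, D i -> F i !=set0) ->
  exists2 W : set I, W `<=` D /\ trivIset W F &
    forall i, D i -> exists2 w, W w & (j w <= j i)%N /\ F i `&` F w !=set0.
Proof.
move=> F0.
pose Q (W : set I) := [/\ W `<=` D, trivIset W F & forall i, D i ->
  (exists2 w, W w & F i `&` F w !=set0) ->
  exists2 w, W w & (j w <= j i)%N /\ F i `&` F w !=set0].
have [W [[WD tW QW] maxW]] : exists A, Q A /\ forall B, A `<` B -> ~ Q B.
  apply: Zorn_bigcup => G GQ tot; split.
  - by apply: bigcup_sub => A /GQ[].
  - move=> x y [A GA Ax] [B GB By] xy.
    have [AB|BA] := tot _ _ GA GB.
    + by have [_ tB _] := GQ _ GB; apply: tB => //; exact: AB.
    + by have [_ tA _] := GQ _ GA; apply: tA => //; exact: BA.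
  - move=> i Di [w [A GA Aw] Fw].
    have [_ _ /(_ i Di)[]] := GQ _ GA; first by exists w.
    by move=> w' Aw' ?; exists w' => //; exists A.
exists W => // i Di; apply: (QW) => //.
apply: contrapT => noti.
(* Among the sets of [D] that meet no member of [W], one of least [j] can be added to [W]: whatever
   meets it but not [W] has at least the same [j]. Sizes in [nat] guarantee that a least one exists,
   so the comparison of sizes loses no constant. *)
pose bad k := `[< exists2 i', D i' & j i' = k /\ ~ exists2 w, W w & F i' `&` F w !=set0 >].
have exbad : exists k, bad k by exists (j i); apply/asboolP; exists i.
case: (ex_minnP exbad) => k /asboolP[x Dx [jx notx]] kmin.
have Wx : ~ W x.
  by move=> Wx; apply: notx; exists x => //; rewrite setIid; exact: F0.
apply: (maxW (W `|` [set x])).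
  rewrite properEneq; split; last by left.
  by apply/eqP => WE; apply: Wx; rewrite WE; right.
split.
- by move=> y [/WD//|->].
- move=> a b [Wa|->] [Wb|->] // ab; first exact: tW.
    by exfalso; apply: notx; exists a => //; rewrite setIC.
  by exfalso; apply: notx; exists b.
- move=> y Dy [w Ww Fyw].
  have [[w' Ww' Fyw']|noy] := pselect (exists2 w, W w & F y `&` F w !=set0).
    have [|w2 ? ?] := QW _ Dy; first by exists w'.
    by exists w2 => //; left.
  case: Ww => [Ww|wx]; first by exfalso; apply: noy; exists w.
  exists w; first by right.
  by split=> //; rewrite wx jx; apply: kmin; apply/asboolP; exists y.
Qed.

Lemma trivIset_open_countable (T : topologicalType) (I : Type) (F : I -> set T)
    (W : set I) : separable T -> (forall i, W i -> open (F i) /\ F i !=set0) ->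
  trivIset W F -> countable W.
Proof.
move=> [D cD dD] oF tW; have [W0|/set0P[i0 Wi0]] := eqVneq W set0; first by rewrite W0; exact: countable0.
have [y0 _] := (oF _ Wi0).2.
have /choice[g gP] (i : I) : exists x : T, W i -> D x /\ F i x.
  have [Wi|nWi] := pselect (W i); last by exists y0.
  have [oFi Fi0] := oF _ Wi.
  by have [y [Fy Dy]] := dD _ Fi0 oFi; exists y.
have /countable_injP[h hI] := cD.
apply/countable_injP; exists (h \o g) => i i' iW i'W /= hh.
have [Wi Wi'] : W i /\ W i' by rewrite !inE in iW i'W.
have gg : g i = g i' by apply: hI => //; rewrite inE; [exact: (gP _ Wi).1|exact: (gP _ Wi').1].
apply: tW => //; exists (g i); split; first exact: (gP _ Wi).2.
by rewrite gg; exact: (gP _ Wi').2.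
Qed.

Section sum_le.
Context {R : numDomainType}.

(** Bounding all finite partial sums gives real-valued sums over an arbitrary set without choosing
    an enumeration. *)
Definition sum_le (I : eqType) (W : set I) (F : I -> R) (a : R) :=
  forall L : seq I, uniq L -> (forall i, i \in L -> W i) ->
  \sum_(i <- L) F i <= a.

Lemma sum_le_bigcup (I J : eqType) (K : set J) (W : J -> set I)
    (F : I -> R) (eps : J -> R) (a : R) :
  (forall k, K k -> sum_le (W k) F (eps k)) -> sum_le K eps a ->
  sum_le (\bigcup_(k in K) W k) F a.
Proof.
move=> Wle Kle L uL LW.
have [->|L0] := eqVneq L [::].
  by rewrite big_nil; have := Kle [::] isT; rewrite big_nil; apply.
have [k0 _] : exists k : J, True.
  by case: L L0 LW {uL} => // x L _ /(_ x (mem_head _ _)) [k _ _]; exists k.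
have /choice[n nP] (i : I) : exists k : J, i \in L -> K k /\ W k i.
  have [iL|] := boolP (i \in L); last by exists k0.
  by have [k Kk Wki] := LW _ iL; exists k.
pose M := undup (map n L).
have -> : \sum_(i <- L) F i = \sum_(k <- M) \sum_(i <- L | n i == k) F i.
  have -> : \sum_(i <- L) F i = \sum_(i <- L) \sum_(k <- M | n i == k) F i.
    rewrite big_seq [RHS]big_seq; apply: eq_bigr => i iL.
    rewrite (big_rem (n i)) /=; last by rewrite mem_undup map_f.
    rewrite eqxx big1_seq ?addr0// => k /andP[/eqP <-].
    by rewrite mem_rem_uniq ?undup_uniq// inE eqxx.
  by rewrite (exchange_big_dep xpredT).
apply: (@le_trans _ _ (\sum_(k <- M) eps k)).
  rewrite big_seq [leRHS]big_seq; apply: ler_sum => k.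
  rewrite mem_undup => /mapP[i iL kE].
  rewrite -big_filter; apply: Wle; rewrite ?filter_uniq//.
    by rewrite kE; exact: (nP _ iL).1.
  by move=> i'; rewrite mem_filter => /andP[/eqP <- i'L]; exact: (nP _ i'L).2.
apply: Kle; first exact: undup_uniq.
by move=> k; rewrite mem_undup => /mapP[i iL ->]; exact: (nP _ iL).1.
Qed.

End sum_le.

(** * Dyadic radii and Lipschitz cutoffs *)

Section dyadic.
Context {R : realType}.

Definition rad (j : nat) : R := 2^-1 ^+ j.

Lemma rad_gt0 j : 0 < rad j. Proof. by rewrite exprn_gt0// invr_gt0. Qed.

Lemma rad_ge0 j : 0 <= rad j. Proof. exact/ltW/rad_gt0. Qed.

Lemma radS j : rad j = 2 * rad j.+1.
Proof. by rewrite /rad exprS mulrA divff ?mul1r// pnatr_eq0. Qed.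

Lemma rad_le i j : (i <= j)%N -> rad j <= rad i.
Proof. by move=> ij; rewrite ler_wiXn2l// ?invr_ge0// invf_le1// ler1n. Qed.

Lemma exprrad j : 2 ^+ j * rad j = 1.
Proof. by rewrite -exprMn divff ?expr1n// pnatr_eq0. Qed.

Lemma rad_small (e : R) : 0 < e -> exists n, rad n < e.
Proof.
move=> e0; have := @cvg_expr R 2^-1; rewrite ger0_norm ?invr_ge0// invf_lt1// ltr1n.
move=> /(_ isT)/cvgrPdist_lt/(_ e e0)[n _ /(_ n (leqnn n))]/=.
by rewrite sub0r normrN ger0_norm ?rad_ge0// => ?; exists n.
Qed.

(** A cutoff equal to 1 up to [rad j.+1], to 0 from [rad j] on, and affine between. Its Lipschitz
    constant 2^(j+1) makes control on a dense sequence of points sufficient. *)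
Definition bump (j : nat) (r : R) : R :=
  Num.max 0 (Num.min 1 (2 - 2 ^+ j.+1 * r)).

Lemma bump_ge0 j r : 0 <= bump j r. Proof. by rewrite /bump le_max lexx. Qed.

Lemma bump_le1 j r : bump j r <= 1.
Proof. by rewrite /bump ge_max ler01 ge_min lexx. Qed.

Lemma bump_eq1 j r : r <= rad j.+1 -> bump j r = 1.
Proof.
move=> rj; rewrite /bump (min_idPl _) ?(max_idPr _)//.
suff : 2 ^+ j.+1 * r <= 1 by lra.
by rewrite -[leRHS](exprrad j.+1) ler_pM2l// exprn_gt0.
Qed.

Lemma bump_eq0 j r : rad j <= r -> bump j r = 0.
Proof.
move=> rj; rewrite /bump (max_idPl _)// ge_min; apply/orP; right.
suff : 2 <= 2 ^+ j.+1 * r by lra.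
have E : 2 ^+ j.+1 * rad j = 2 by rewrite exprS -mulrA exprrad mulr1.
by rewrite -[leLHS]E ler_pM2l ?exprn_gt0.
Qed.

Lemma bump_lip j r r' : bump j r <= bump j r' + 2 ^+ j.+1 * `|r - r'|.
Proof.
have : 2 ^+ j.+1 * r' - 2 ^+ j.+1 * r <= 2 ^+ j.+1 * `|r - r'|.
  rewrite -mulrBr ler_pM2l ?exprn_gt0// distrC; exact: ler_norm.
have : 0 <= 2 ^+ j.+1 * `|r - r'| by rewrite mulr_ge0// exprn_ge0.
rewrite /bump; set p := 2 ^+ j.+1 * r; set p' := 2 ^+ j.+1 * r'; set q := _ * `| _ |.
move=> q0 pq.
rewrite ge_max; apply/andP; split; first by rewrite addr_ge0// le_max lexx.
case: (leP 1 (2 - p')) => p1.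
  have : Num.max 0 (1:R) = 1 by rewrite (max_idPr _).
  move=> ->; rewrite ge_min; apply/orP; left; lra.
have : 2 - p' <= Num.max 0 (2 - p') by rewrite le_max lexx orbT.
move: (Num.max _ _) => M pM; rewrite ge_min; apply/orP; right; lra.
Qed.

End dyadic.

Section ulim.
Context {R : realType}.

Lemma free_ultra : exists U : set_system nat, UltraFilter U /\ \oo `<=` U.
Proof. exact: ultraFilterLemma. Qed.

Lemma bounded_ultra_cvg (U : set_system nat) (UU : UltraFilter U) (a : nat -> R)
  (c : R) : (forall n, 0 <= a n <= c) -> exists l : R, a @ U --> l.
Proof.
move=> ac.
have UaU : UltraFilter (a @ U).
  have PF : ProperFilter (a @ U) by exact: fmap_proper_filter.
  split=> // G PG aUG; apply/seteqP; split => // A GA.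
  have [//|UnA] := in_ultra_setVsetC (a @^-1` A) UU.
  have : G (~` A) by apply: aUG; rewrite /= /fmap /= nbhs_filterE.
  move=> GnA; have : G (A `&` ~` A) by exact: filterI.
  by rewrite setICr => /filter_not_empty.
have : compact `[0, c]%classic by exact: segment_compact.
rewrite compact_ultra => /(_ _ UaU)[|l [_ al]]; last by exists l.
apply: (@filterS _ U _ setT) => [n _ /=|]; last exact: filterT.
by rewrite in_itv/=; exact: ac.
Qed.

Definition ulim (U : set_system nat) (a : nat -> R) : R := lim (a @ U).

Lemma ulimP (U : set_system nat) (UU : UltraFilter U) (a : nat -> R)
  (c : R) : (forall n, 0 <= a n <= c) -> a @ U --> ulim U a.
Proof. by move=> /(bounded_ultra_cvg UU)[l al]; apply/cvg_ex; exists l. Qed.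

End ulim.

Lemma ler_sum_sub (R : numDomainType) (I : eqType) (s s' : seq I) (F : I -> R) :
  uniq s -> uniq s' -> {subset s <= s'} -> (forall i, 0 <= F i) ->
  \sum_(i <- s) F i <= \sum_(i <- s') F i.
Proof.
move=> us us' ss' F0; rewrite (perm_big [seq i <- s' | i \in s]) /=; last first.
  apply: uniq_perm; rewrite ?filter_uniq// => i; rewrite mem_filter.
  by case: (boolP (i \in s)) => // /ss' ->.
rewrite big_filter big_mkcond; apply: ler_sum => i _.
by case: ifP.
Qed.

Lemma geometric_tail (R : numDomainType) (r : R) (m n : nat) : 0 <= r ->
  (1 - r) * \sum_(m <= j < n) r ^+ j <= r ^+ m.
Proof.
move=> r0; have [nm|/ltnW mn] := leqP n m; first by rewrite big_geq// mulr0 exprn_ge0.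
rewrite mulr_sumr (telescope_sumr_eq (fun j => - r ^+ j))//; last first.
  by move=> k _; rewrite exprS; ring.
by rewrite opprK addrC lerBlDr lerDl exprn_ge0.
Qed.

Lemma open_mdist_lt (R : realType) (T : metricType R) (x : T) (r : R) :
  open [set y | mdist x y < r].
Proof.
rewrite openE => y /= xy; rewrite /interior; apply/nbhs_ballP.
exists (r - mdist x y) => /=; first by rewrite subr_gt0.
move=> z; rewrite ballEmdist /= => yz.
by apply: le_lt_trans (metric_triangle x y z) _; rewrite -ltrBrDl.
Qed.

Lemma mdist_tri_lt (R : realType) (T : metricType R) (x y z : T) (r r' : R) :
  mdist x z < r -> mdist y z < r' -> mdist x y <= r + r'.
Proof.
move=> xz yz; apply: (le_trans (metric_triangle x z y)).
by rewrite (metric_sym z); apply: ltW; apply: ltrD.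
Qed.

(** * Null sets and generalized measures *)

Section null.
Context {R : realType} {Z : completeMetricType R}.
Hypothesis sepZ : separable Z.
Implicit Types (q : R) (A : set Z).

(* [q ^+ j] stands for the [s]-th power of the radius [2 ^- j], i.e. [q] is
   [2 `^ (- s)]: these are the null sets of the [s]-dimensional measure. *)
Definition null q A := forall eps : R, 0 < eps -> exists W : set (nat * Z),
  [/\ countable W,
    forall x, A x -> exists2 p, W p & mdist p.2 x <= 2 * rad p.1 &
    sum_le W (fun p => q ^+ p.1) eps].

Lemma null_sub q A B : A `<=` B -> null q B -> null q A.
Proof.
by move=> AB nB e /nB[W [cW WB We]]; exists W; split => // x /AB; exact: WB.
Qed.

Lemma null_le q q' A : 0 <= q' -> q' <= q -> null q A -> null q' A.
Proof.
move=> q'0 q'q nA e /nA[W [cW WA We]]; exists W; split => // L uL LW.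
apply: le_trans (We L uL LW); apply: ler_sum => p _.
by rewrite lerXn2r// nnegrE (le_trans q'0).
Qed.

Lemma sum_rad_le1 (I : eqType) (K : set I) (h : I -> nat) :
  {in K &, injective h} -> sum_le K (fun k => rad (h k).+1) (1 : R).
Proof.
move=> hI L uL LK; rewrite -(big_map h xpredT (fun n => rad n.+1)).
have umL : uniq (map h L).
  rewrite map_inj_in_uniq// => x y /LK Kx /LK Ky; apply: hI; exact/mem_set.
pose N := (\max_(n <- map h L) n).+1.
apply: (@le_trans _ _ (\sum_(n <- index_iota 0 N) rad n.+1)).
  apply: ler_sum_sub => [||n nL|n]; rewrite ?iota_uniq ?rad_ge0//.
  by rewrite mem_index_iota /= ltnS; exact: leq_bigmax_seq.
have := @geometric_tail R 2^-1 0 N; rewrite invr_ge0 ler0n => /(_ isT).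
rewrite expr0 (_ : 1 - 2^-1 = 2^-1 :> R); last by field.
rewrite mulr_sumr => H; apply: le_trans H; apply: ler_sum => n _.
by rewrite /rad exprS.
Qed.

Lemma null_bigcup (I : eqType) q (K : set I) (A : I -> set Z) : countable K ->
  (forall k, K k -> null q (A k)) -> null q (\bigcup_(k in K) A k).
Proof.
move=> /countable_injP[h hI] nA e e0.
have /choice[W WP] (k : I) : exists W : set (nat * Z), K k -> [/\ countable W,
    forall x, A k x -> exists2 p, W p & mdist p.2 x <= 2 * rad p.1 &
    sum_le W (fun p => q ^+ p.1) (e * rad (h k).+1)].
  have [Kk|] := pselect (K k); last by exists set0.
  have [|W ?] := nA _ Kk (e * rad (h k).+1); last by exists W.
  by rewrite mulr_gt0// rad_gt0.
exists (\bigcup_(k in K) W k); split.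
- apply: bigcup_countable => [|k /WP[]//]; by apply/countable_injP; exists h.
- by move=> x [k Kk Ax]; have [_ /(_ x Ax)[p ? ?] _] := WP _ Kk; exists p => //; exists k.
- apply: (sum_le_bigcup (eps := fun k => e * rad (h k).+1)).
    by move=> k /WP[].
  move=> L uL LK; rewrite -mulr_sumr ler_piMr ?(ltW e0)//.
  exact: (sum_rad_le1 hI).
Qed.

Lemma nullU q A B : null q A -> null q B -> null q (A `|` B).
Proof.
move=> nA nB; rewrite (_ : A `|` B = \bigcup_(b in [set: bool]) (if b then A else B)).
  by apply: null_bigcup => [|[]] //; exact: countableP.
apply/seteqP; split => [x [Ax|Bx]|x [[] _]]; by [exists true|exists false|left|right].
Qed.

Definition bumps (L : seq (nat * Z)) (y : Z) : R :=
  \sum_(p <- L) bump p.1 (mdist p.2 y).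

(** Bumps of disjoint open balls have disjoint supports, so their sum never exceeds 1: such lists
    are the test functions for the mass of a packing functional. A selected ball is at least as
    large as those it absorbs, whence the factor 2. *)
Lemma disjoint_cover (D : set (nat * Z)) : exists W : set (nat * Z),
  [/\ W `<=` D, countable W,
    forall p, D p -> exists2 w, W w & (w.1 <= p.1)%N /\ mdist w.2 p.2 <= 2 * rad w.1 &
    forall L, uniq L -> (forall p, p \in L -> W p) -> forall y, bumps L y <= 1].
Proof.
pose F (p : nat * Z) := [set y : Z | mdist p.2 y < rad p.1].
have F0 p : F p !=set0 by exists p.2; rewrite /F /= mdistxx rad_gt0.
have [W [WD tW] WP] := @vitali_disjoint _ _ F fst D (fun p _ => F0 p).
exists W; split => //.
- apply: (trivIset_open_countable sepZ _ tW) => p _; split => //.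
  exact: open_mdist_lt.
- move=> p Dp; have [w Ww [wp [y [py wy]]]] := WP _ Dp; exists w => //; split => //.
  rewrite mulr_natl mulr2n; apply: le_trans (mdist_tri_lt wy py) _.
  by rewrite lerD2l rad_le.
- move=> L uL LW y; have [[p pL py]|noy] := pselect (exists2 p, p \in L & F p y).
    rewrite /bumps (bigD1_seq p)//= big_seq_cond big1 ?addr0 ?bump_le1//.
    move=> p' /andP[p'L p'p]; rewrite bump_eq0// leNgt; apply/negP => p'y.
    by move/eqP: p'p; apply; apply: tW; [exact: LW|exact: LW|exists y].
  rewrite /bumps big_seq big1 ?ler01// => p pL; rewrite bump_eq0// leNgt.
  by apply/negP => py; apply: noy; exists p.
Qed.

(* Functionals modelled on [u j x = \int bump j (mdist x y) dmu(y)], mu of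
   mass at most [c]. Unlike measures, they are closed under pointwise limits. *)
Definition packing (c : R) (u : nat -> Z -> R) :=
  [/\ forall j x, 0 <= u j x,
    forall j x x', u j x <= u j x' + c * 2 ^+ j.+1 * mdist x x',
    forall L, (forall y, bumps L y <= 1) -> \sum_(p <- L) u p.1 p.2 <= c &
    forall L j x, (forall y, bumps L y <= bump j (mdist x y)) ->
      \sum_(p <- L) u p.1 p.2 <= u j x].

Lemma packing_le c u : packing c u -> forall j x, u j x <= c.
Proof.
move=> [_ _ H _] j x; have := H [:: (j, x)]; rewrite big_seq1/=; apply=> y.
by rewrite /bumps big_seq1 bump_le1.
Qed.

Lemma sum_leZ (I : eqType) (W : set I) (F G : I -> R) (a t : R) : 0 < t ->
  (forall L, uniq L -> (forall i, i \in L -> W i) -> \sum_(i <- L) G i <= a) ->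
  (forall i, W i -> t * F i <= G i) -> sum_le W F (a / t).
Proof.
move=> t0 Ga FG L uL LW; rewrite ler_pdivlMr// mulrC mulr_sumr.
apply: le_trans (Ga L uL LW); rewrite big_seq [leRHS]big_seq; apply: ler_sum => i iL.
exact/FG/LW.
Qed.

Lemma packing_cover c u q t (D : set (nat * Z)) : packing c u -> 0 < t ->
  (forall p, D p -> t * q ^+ p.1 <= u p.1 p.2) ->
  exists W : set (nat * Z), [/\ W `<=` D, countable W,
    forall p, D p -> exists2 w, W w & mdist w.2 p.2 <= 2 * rad w.1 &
    sum_le W (fun p => q ^+ p.1) (c / t)].
Proof.
move=> [_ _ H _] t0 Dt; have [W [WD cW WP WL]] := disjoint_cover D.
exists W; split => //; first by move=> p /WP[w ? []]; exists w.
apply: (@sum_leZ _ _ _ (fun p => u p.1 p.2)) => // [L uL LW|p /WD/Dt//].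
by apply: H; exact: WL.
Qed.

(** A ball of radius at most [rad i.+2] centred within [rad i.+2] of [x0] stays within [rad i.+1] of
    [x0], where [bump i] is 1. The disjoint family is thus paid for by the single value [u i x0]
    instead of the total mass. *)
Lemma local_cover c u q t (x0 : Z) i (D : set (nat * Z)) : packing c u -> 0 < t ->
  (forall p, D p -> [/\ (i.+2 <= p.1)%N, mdist x0 p.2 <= rad i.+2 & t * q ^+ p.1 <= u p.1 p.2]) ->
  exists W : set (nat * Z), [/\ W `<=` D, countable W,
    forall p, D p -> exists2 w, W w & mdist w.2 p.2 <= 2 * rad w.1 &
    sum_le W (fun p => q ^+ p.1) (u i x0 / t)].
Proof.
move=> [_ _ _ H] t0 Dt; have [W [WD cW WP WL]] := disjoint_cover D.
exists W; split => //; first by move=> p /WP[w ? []]; exists w.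
apply: (@sum_leZ _ _ _ (fun p => u p.1 p.2)) => // [L uL LW|p /WD/Dt[]//].
apply: H => y; have [near|far] := leP (mdist x0 y) (rad i.+1).
  by rewrite (bump_eq1 near); exact: WL.
rewrite /bumps big_seq big1 ?bump_ge0// => p /LW/WD/Dt[ip x0p _].
rewrite bump_eq0//; have := metric_triangle x0 p.2 y.
have := rad_le (R := R) ip; have := radS (R := R) i.+1; move: far x0p; lra.
Qed.

End null.

(** * Potentials and charged sets *)

Section capacity.
Context {R : realType} {Z : completeMetricType R}.
Hypothesis sepZ : separable Z.
Implicit Types (A : set Z) (u : nat -> Z -> R).

Definition potential (a : R) u n x := \sum_(0 <= j < n) a ^+ j * u j x.

Definition potential_ge1 a u x := forall t, t < 1 -> exists n, t < potential a u n x.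

(** If every term from [m] on had u j x < t q^j, the tail would be at most the geometric sum t (a
    q)^m / (1 - a q), hence at most [e]. *)
Lemma exists_large_term (a q t e : R) u x m n : 0 <= a -> 0 < q -> a * q < 1 ->
  0 <= t -> t * (a * q) ^+ m <= e * (1 - a * q) ->
  e < \sum_(m <= j < n) a ^+ j * u j x ->
  exists2 j, (m <= j)%N & t * q ^+ j <= u j x.
Proof.
move=> a0 q0 aq t0 te; apply: contraPP => small.
have {}small j : (m <= j)%N -> u j x <= t * q ^+ j.
  by move=> mj; rewrite leNgt; apply/negP => /ltW ?; apply: small; exists j.
apply/negP; rewrite -leNgt.
have aq0 : 0 <= a * q by rewrite mulr_ge0// ltW.
apply: (@le_trans _ _ (t * \sum_(m <= j < n) (a * q) ^+ j)).
  rewrite mulr_sumr !big_nat; apply: ler_sum => j /andP[mj _].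
  rewrite exprMn mulrCA; apply: ler_wpM2l; first exact: exprn_ge0.
  exact: small.
have aq1 : 0 < 1 - a * q by rewrite subr_gt0.
rewrite -(ler_pM2r aq1); apply: le_trans te; rewrite -mulrA; apply: ler_wpM2l => //.
by rewrite mulrC; exact: geometric_tail.
Qed.

Variables (a q q' : R).
Hypotheses (a0 : 0 < a) (q'0 : 0 < q') (q'q : q' < q) (aq1 : a * q < 1) (q1 : q < 1).

Let q0 : 0 < q. Proof. exact: lt_trans q'q. Qed.
Let aq0 : 0 < a * q. Proof. exact: mulr_gt0. Qed.
Let aq'1 : a * q' < 1. Proof. by apply: lt_trans aq1; rewrite ltr_pM2l. Qed.

(** Capacity at most [c]. The potential reaches 1 only in the supremum over truncations, and only
    off a null set; both relaxations serve to make the notion stable under increasing unions. *)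
Definition charged (c : R) A := exists u N,
  [/\ packing c u, null q' N & forall x, A x -> ~ N x -> potential_ge1 a u x].

Lemma charged_sub (c : R) A B : A `<=` B -> charged c B -> charged c A.
Proof. by move=> AB [u [N [? ? uB]]]; exists u, N; split => // x /AB; exact: uB. Qed.

(** Off [N] the potential exceeds 1/2, which forces u j x >= t q'^j at some scale, t being the value
    at which the geometric bound t / (1 - a q') equals 1/2. Disjoint balls of this kind have total
    cost at most c / t, which is e / 2. *)
Lemma charged_null A : (forall c, 0 < c -> charged c A) -> null q' A.
Proof.
move=> cA e e0.
pose t := (1 - a * q') / 2.
have t0 : 0 < t by rewrite divr_gt0// subr_gt0.
have e2 : 0 < e / 2 by rewrite divr_gt0.
have [|u [N [pu nN uA]]] := cA (e / 2 * t); first by rewrite mulr_gt0.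
suff nD : exists W : set (nat * Z),
  [/\ countable W,
    forall x, (A `\` N) x -> exists2 p, W p & mdist p.2 x <= 2 * rad p.1 &
    sum_le W (fun p => q' ^+ p.1) (e / 2)].
  have [W [cW WA We]] := nD; have [W' [cW' WA' We']] := nN _ e2.
  exists (\bigcup_(b in [set: bool]) (if b then W else W')); split.
  - by apply: bigcup_countable => [|[]] //; exact: countableP.
  - move=> x Ax; have [Nx|nNx] := pselect (N x).
      by have [p ? ?] := WA' _ Nx; exists p => //; exists false.
    by have [p ? ?] := WA _ (conj Ax nNx); exists p => //; exists true.
  - apply: (sum_le_bigcup (eps := fun=> e / 2)) => [[]//|L uL _].
    have : (size L <= size [:: true; false])%N by apply: uniq_leq_size => // -[].
    rewrite big_const_seq count_predT iter_addr addr0 /= => sL.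
    rewrite [leRHS](splitr e) -mulr2n.
    by rewrite -[leLHS]mulr_natr -[leRHS]mulr_natr ler_pM2l// ler_nat.
have [|W [WD cW WP We]] := packing_cover (q := q') (D := [set p | t * q' ^+ p.1 <= u p.1 p.2])
    sepZ pu t0; first by [].
exists W; split => //.
  move=> x [Ax nNx]; have [|n] := uA x Ax nNx (1/2); first by rewrite ltr_pdivrMr// mul1r ltr1n.
  move=> /(@exists_large_term a q' t) [|||||j _ jP].
  - exact: ltW.
  - by [].
  - by [].
  - exact: ltW.
  - by rewrite expr0 mulr1 /t mulrC div1r.
  - by have [w ? ?] := WP (j, x) jP; exists w.
by move: We; rewrite mulfK// gt_eqF.
Qed.

(** On [D] the limit has little mass at all scales from [i0] on, yet every late [v m] has a large
    term somewhere. Near a point of [D] that term must sit at a much finer scale, and the balls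
    found there cost at most half of the ball that they refine. Iterating the refinement makes the
    cost arbitrarily small. *)
Lemma bad_null (c t : R) (D : set Z) (v : nat -> nat -> Z -> R) u (i0 m0 : nat) :
  (forall m, packing c (v m)) -> (forall j x, (fun m => v m j x) @ \oo --> u j x) ->
  0 < t -> 4 <= t * q ^+ 3 ->
  (forall x, D x -> forall m, (m0 <= m)%N ->
     exists2 j, (i0.+3 <= j)%N & t * q ^+ j <= v m j x) ->
  (forall x, D x -> forall j, (i0 <= j)%N -> u j x <= q ^+ j) ->
  null q D.
Proof.
move=> pv vu t0 tq Dv Du.
have step x0 i : D x0 -> (i0 <= i)%N -> exists W : set (nat * Z),
    [/\ W `<=` [set p | D p.2 /\ (i0 <= p.1)%N], countable W,
      forall x, D x -> mdist x0 x <= rad i.+2 -> exists2 p, W p & mdist p.2 x <= rad p.1.+2 &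
      sum_le W (fun p => q ^+ p.1) (1/2 * q ^+ i)].
  move=> Dx0 i0i.
  (* Convergence at [x0] on the finitely many scales up to [i] yields one [m]. It depends on [x0]
     and [i], so every ball is refined with its own [m]. *)
  have [m [m0m vm]] : exists m, (m0 <= m)%N /\
      forall k, (i0 <= k <= i)%N -> v m k x0 <= 2 * q ^+ k.
    have H : \forall m \near \oo, (m0 <= m)%N /\
        forall k : 'I_i.+1, (i0 <= k)%N -> v m k x0 <= 2 * q ^+ k.
      near=> m; split; first by near: m; exact: nbhs_infty_ge.
      near: m; apply: filter_forall => k; have [ik|] := boolP (i0 <= k)%N; last first.
        by move=> _; near=> m.
      have qk : 0 < q ^+ k by rewrite exprn_gt0.
      have /cvgrPdist_le/(_ _ qk) := vu k x0; apply: filterS => m + _.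
      move=> /ler_normlP[+ _]; have := Du _ Dx0 _ ik; lra.
    have [m [m0m vm]] := filter_ex H.
    exists m; split => // k /andP[ik ki].
    exact: (vm (Ordinal (ki : (k < i.+1)%N))).
  pose E := [set p : nat * Z | D p.2 /\ mdist x0 p.2 <= rad i.+2 /\ (i0.+3 <= p.1)%N /\
      t * q ^+ p.1 <= v m p.1 p.2].
  (* At a scale j <= i + 2 the large term would be at most v m (j - 2) x0 <= 2 q^(j-2), against t
     q^2 >= 4. *)
  have EP p : E p -> (i.+3 <= p.1)%N.
    case: p => j x [/= Dx [x0x [ij tv]]]; rewrite leqNgt; apply/negP.
    rewrite ltnS => ji.
    have j2 : j = j.-2.+2 by move: ij; clear; case: j => [|[|]].
    have [_ _ _ /(_ [:: (j, x)] j.-2 x0)] := pv m; rewrite big_seq1 /= => H.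
    have : v m j x <= v m j.-2 x0.
      apply: H => y; rewrite /bumps big_seq1/=.
      have [near|far] := leP (mdist x0 y) (rad (R:=R) j.-2.+1).
        by rewrite (bump_eq1 near) bump_le1.
      rewrite bump_eq0 ?bump_ge0//; have := metric_triangle x0 x y.
      have := rad_le (R := R) (ji : (j <= i.+2)%N).
      have := radS (R := R) j.-2.+1; rewrite -j2; move: far x0x; lra.
    have : v m j.-2 x0 <= 2 * q ^+ j.-2 by apply: vm; move: ij ji; clear; lia.
    move: tv; rewrite {1}j2 => tv v2 vv.
    have : t * q ^+ j.-2.+2 <= 2 * q ^+ j.-2 by exact: (le_trans tv (le_trans vv v2)).
    rewrite (_ : q ^+ j.-2.+2 = q ^+ 2 * q ^+ j.-2); last by rewrite -exprD.
    rewrite mulrA ler_pM2r ?exprn_gt0//.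
    rewrite leNgt => /negP; apply.
    apply: (@lt_le_trans _ _ 4); first by rewrite ltr_nat.
    apply: le_trans tq _; rewrite exprS mulrCA ler_piMl ?(ltW q1)//.
    by rewrite mulr_ge0// ?exprn_ge0// ltW.
  have [p|W [WE cW WP Wle]] := @local_cover R Z sepZ c (v m) q t x0 i E (pv m) t0.
    move=> Ep; split; first by exact/ltnW/(EP p Ep).
      by case: Ep => _ [].
    by case: Ep => _ [_ []].
  (* Relabelling scale j as j - 3 turns the covering radius 2 [rad] j into [rad] ((j - 3) + 2), the
     form from which the refinement can be repeated. The cost grows by q^-3, which t q^3 >= 4 pays
     for. *)
  pose W' := (fun p : nat * Z => (p.1 - 3, p.2)%N) @` W.
  have WW p : W p -> p = ((p.1 - 3).+3, p.2).
    by move=> /WE/EP; clear; case: p => j x /= ij; congr pair; lia.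
  exists W'; split.
  - move=> _ [p Wp <-] /=; split; first by have [] := WE _ Wp.
    by have [_ [_ [+ _]]] := WE _ Wp; clear; lia.
  - exact: (sub_countable (card_image_le _ _)).
  - move=> x Dx x0x; have [j ij jP] := Dv x Dx m m0m.
    have [//|w Ww wx] := WP (j, x); exists (w.1 - 3, w.2)%N; first by exists w.
    move: wx; rewrite (WW _ Ww) /= => wx; apply: le_trans wx _.
    by rewrite subSS subSS subSS subn0 (radS (R:=R) (w.1 - 3).+2).
  - move=> L uL LW.
    rewrite -(@ler_pM2r _ (q ^+ 3)) ?exprn_gt0// mulr_suml.
    pose L' := [seq ((p.1).+3, p.2) | p <- L].
    have := Wle L'; rewrite map_inj_uniq => [|[? ?] [? ?] [-> ->]//] => /(_ uL).
    rewrite big_map /= => H.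
    apply: (@le_trans _ _ (v m i x0 / t)).
      rewrite (eq_bigr (fun p => q ^+ p.1.+3)); last by move=> p _; rewrite -exprD addn3.
      apply: H => _ /mapP[p pL ->]; have [w Ww pE] := LW _ pL.
      by rewrite -pE /= -WW.
    rewrite ler_pdivrMr//; apply: le_trans (vm i _) _; first by rewrite i0i leqnn.
    have qi : 0 < q ^+ i by rewrite exprn_gt0.
    rewrite (_ : 1 / 2 * q ^+ i * q ^+ 3 * t = (1/2 * (t * q ^+ 3)) * q ^+ i); last by ring.
    by rewrite ler_pM2r//; lra.
have iter n x0 i : D x0 -> (i0 <= i)%N -> exists W : set (nat * Z),
    [/\ W `<=` [set p | D p.2 /\ (i0 <= p.1)%N], countable W,
      forall x, D x -> mdist x0 x <= rad i.+2 -> exists2 p, W p & mdist p.2 x <= rad p.1.+2 &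
      sum_le W (fun p => q ^+ p.1) (rad n * q ^+ i)].
  elim: n => [|n IH] Dx0 i0i.
    exists [set (i, x0)]; split => //.
    - by move=> _ -> /=.
    - by move=> x Dx xx0; exists (i, x0).
    - move=> L uL LW; rewrite mul1r.
      have : (size L <= size [:: (i, x0)])%N.
        by apply: uniq_leq_size => // p /LW ->; rewrite mem_head.
      case: L {uL} LW => [|p [|//]] LW _; first by rewrite big_nil exprn_ge0// ltW.
      by rewrite big_seq1 (LW p (mem_head _ _)).
  have [W [WD cW WP Wle]] := IH Dx0 i0i.
  have /choice[V VP] (p : nat * Z) : exists V : set (nat * Z), W p ->
     [/\ V `<=` [set p | D p.2 /\ (i0 <= p.1)%N], countable V,
      forall x, D x -> mdist p.2 x <= rad p.1.+2 -> exists2 p, V p & mdist p.2 x <= rad p.1.+2 &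
      sum_le V (fun p => q ^+ p.1) (1/2 * q ^+ p.1)].
    have [Wp|] := pselect (W p); last by exists set0.
    by have [Dp ip] := WD _ Wp; have [V ?] := step _ _ Dp ip; exists V.
  exists (\bigcup_(p in W) V p); split.
  - by move=> p [k /VP[VD _ _ _] /VD].
  - by apply: bigcup_countable => // p /VP[].
  - move=> x Dx x0x; have [p Wp px] := WP _ Dx x0x.
    have [_ _ /(_ x Dx px)[p' ? ?] _] := VP _ Wp; exists p' => //; by exists p.
  - apply: (sum_le_bigcup (eps := fun p => 1/2 * q ^+ p.1)); first by move=> p /VP[].
    move=> L uL LW; rewrite -mulr_sumr.
    by have := Wle L uL LW; rewrite (radS (R:=R) n) -mulrA; lra.
(* As 2 [rad i0.+3] = [rad i0.+2], the set [D] is covered by countably many balls of the size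
   treated by [iter]. *)
have [W [WD cW WP _]] := disjoint_cover sepZ [set p : nat * Z | D p.2 /\ p.1 = (i0.+3)%N].
apply: (@null_sub _ _ _ _ (\bigcup_(p in W) (D `&` [set x | mdist p.2 x <= rad i0.+2]))).
  move=> x Dx; have [//|w Ww [_ wx]] := WP (i0.+3, x); exists w => //; split => //=.
  by have [_ w1] := WD _ Ww; move: wx; rewrite w1 -radS.
apply: null_bigcup => // w Ww e e0; have [Dw _] := WD _ Ww.
have [n nP] := rad_small e0; have [W' [W'D cW' W'P W'le]] := iter n _ _ Dw (leqnn i0).
exists W'; split => //.
  move=> x [Dx wx]; have [p Wp px] := W'P _ Dx wx; exists p => //.
  apply: le_trans px _; have := rad_ge0 (R:=R) p.1.
  have : rad p.1.+2 <= rad (R:=R) p.1 by apply: rad_le; rewrite ltnW.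
  by move: (rad p.1.+2) (rad p.1) => r r'; lra.
move=> L uL LW; apply: le_trans (W'le L uL LW) _.
apply: le_trans (ltW nP); rewrite ler_piMr ?rad_ge0//.
by rewrite exprn_ile1// ltW.
Unshelve. all: by end_near. Qed.

(** The selected disjoint balls with u j x >= q^j have total q-cost at most c, and at scales j >= n
    one has q'^j <= (q'/q)^n q^j. *)
Lemma good_null (c : R) (D : set Z) u : 0 < c -> packing c u ->
  (forall x, D x -> forall i, exists2 j, (i <= j)%N & q ^+ j <= u j x) -> null q' D.
Proof.
move=> c0 pu Du e e0.
have r1 : q' / q < 1 by rewrite ltr_pdivrMr// mul1r.
have r0 : 0 < q' / q by rewrite divr_gt0.
have [n nP] : exists n, c * (q' / q) ^+ n < e.
  have := @cvg_expr R (q' / q); rewrite ger0_norm ?(ltW r0)// => /(_ r1).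
  move=> /cvgrPdist_lt/(_ (e / c)); rewrite divr_gt0// => /(_ isT)[n _ /(_ n (leqnn n))]/=.
  rewrite sub0r normrN ger0_norm ?exprn_ge0 ?(ltW r0)// => H; exists n.
  by rewrite mulrC -ltr_pdivlMr.
have [|W [WD cW WP Wle]] := packing_cover (q := q)
   (D := [set p | (n <= p.1)%N /\ q ^+ p.1 <= u p.1 p.2]) sepZ pu (@ltr01 R).
  by move=> p [_]; rewrite mul1r.
exists W; split => //.
  move=> x Dx; have [j nj jP] := Du x Dx n.
  by have [//|w Ww ?] := WP (j, x); exists w.
move=> L uL LW; apply: le_trans (ltW nP).
apply: (@le_trans _ _ ((q' / q) ^+ n * \sum_(p <- L) q ^+ p.1)); last first.
  rewrite mulrC ler_wpM2r// ?exprn_ge0 ?(ltW r0)//; have := Wle L uL LW.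
  by rewrite divr1.
rewrite mulr_sumr big_seq [leRHS]big_seq; apply: ler_sum => p /LW/WD[np _].
rewrite -ler_pdivrMr ?exprn_gt0// -expr_div_n.
by apply: ler_wiXn2l => //; exact: ltW.
Qed.

End capacity.

(** * Compactness of generalized measures and increasing unions *)

Section limits.
Context {R : realType} {Z : completeMetricType R}.
Hypothesis sepZ : separable Z.
Implicit Types (A : set Z) (u : nat -> Z -> R).

Lemma cvg_sumR (I T : Type) (F : set_system T) (FF : Filter F) (r : seq I)
    (f : I -> T -> R) (l : I -> R) : (forall i, f i x @[x --> F] --> l i) ->
  \sum_(i <- r) f i x @[x --> F] --> \sum_(i <- r) l i.
Proof. by move=> fl; apply: cvg_big => // x; exact: add_continuous. Qed.

Lemma dense_sequence (T : metricType R) (x0 : T) : separable T ->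
  exists e : nat -> T, forall x (r : R), 0 < r -> exists n, mdist x (e n) < r.
Proof.
move=> [D /countable_injP[h hI] dD].
have /choice[e eP] (n : nat) : exists y : T, forall x, D x -> h x = n -> y = x.
  have [[y [Dy hy]]|no] := pselect (exists y, D y /\ h y = n).
    by exists y => x Dx hx; apply: hI; rewrite ?inE// hy.
  by exists x0 => x Dx hx; exfalso; apply: no; exists x.
exists e => x r r0; have [|y [xy Dy]] := dD _ _ (open_mdist_lt x r).
  by exists x; rewrite /= mdistxx.
by exists (h y); rewrite (eP _ y).
Qed.

Lemma packing_lim (T : topologicalType) (F : set_system T) (FF : ProperFilter F) c (v : T -> nat -> Z -> R) u :
  (forall m, packing c (v m)) -> (forall j x, v m j x @[m --> F] --> u j x) ->
  packing c u.
Proof.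
move=> pv vu; split.
- move=> j x; apply: (ler_cvg_to (cvg_cst 0) (vu j x)).
  by apply: nearW => m; have [+ _ _ _] := pv m; exact.
- move=> j x x'; apply: (ler_cvg_to (vu j x) (cvgD (vu j x') (cvg_cst _))).
  by apply: nearW => m; have [_ + _ _] := pv m; exact.
- move=> L L1; have vL := cvg_sumR FF (r := L) (f := fun p m => v m p.1 p.2) (fun p => vu p.1 p.2).
  apply: (@ler_cvg_to _ _ _ _ _ (fun=> c) _ c vL); first exact: cvg_cst.
  by apply: nearW => m; have [_ _ + _] := pv m; exact.
- move=> L j x Lx; have vL := cvg_sumR FF (r := L) (f := fun p m => v m p.1 p.2) (fun p => vu p.1 p.2).
  apply: (@ler_cvg_to _ _ _ _ _ _ _ _ vL (vu j x)).
  by apply: nearW => m; have [_ _ _] := pv m; exact.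
Qed.

(** Ultrafilter limits exist at once, but points will be sorted into countably many sets by the
    index from which an estimate holds, which calls for a sequence. A diagonal choice settles a
    dense sequence of points, and the common Lipschitz bounds settle all others. *)
Lemma packing_compact (c : R) (v : nat -> nat -> Z -> R) : 0 < c -> (forall m, packing c (v m)) ->
  exists phi u, [/\ forall n, (n <= phi n)%N, packing c u &
    forall j x, v (phi n) j x @[n --> \oo] --> u j x].
Proof.
move=> c0 pv; have [U [UU Uoo]] := free_ultra.
pose u j x := ulim U (fun m => v m j x).
have vu j x : v m j x @[m --> U] --> u j x.
  apply: (@ulimP _ U UU _ c) => m; rewrite (packing_le (pv m)) andbT.
  by have [+ _ _ _] := pv m; exact.
have pu : packing c u := packing_lim (@ultra_proper _ U UU) pv vu.
have [e eP] := dense_sequence point sepZ.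
have /choice[phi phiP] (n : nat) : exists m, (n <= m)%N /\
    forall i j : 'I_n, `|u j (e i) - v m j (e i)| < n.+1%:R^-1.
  apply: (@filter_ex _ U); near=> m; split.
    near: m; apply: Uoo; exact: nbhs_infty_ge.
  near: m; apply: filter_forall => i; apply: filter_forall => j.
  have /cvgrPdist_lt := vu j (e i); apply; by rewrite invr_gt0.
exists phi, u; split; [by move=> n; have [] := phiP n|exact: pu|].
move=> j x; apply/cvgrPdist_lt => r r0.
pose k := c * 2 ^+ j.+1.
have k0 : 0 < k by rewrite mulr_gt0// exprn_gt0.
have [i] := eP x (r / (4 * k)) (divr_gt0 r0 (mulr_gt0 (ltr0n _ 4) k0)).
move=> xi.
have lip w : packing c w -> `|w j x - w j (e i)| <= r / 4.
  move=> [_ H _ _]; have xk : k * mdist x (e i) <= r / 4.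
    rewrite mulrC -ler_pdivlMr// -mulrA -invfM; exact: ltW.
  apply/ler_normlP; have := H j x (e i); have := H j (e i) x.
  by rewrite (metric_sym (e i)) -/k; split; lra.
near=> n.
have ni : (i < n)%N by near: n; exact: nbhs_infty_gt.
have nj : (j < n)%N by near: n; exact: nbhs_infty_gt.
have [_ /(_ (Ordinal ni) (Ordinal nj))/= phn] := phiP n.
have nr : n.+1%:R^-1 < r / 4 :> R.
  near: n; have r4 : 0 < r / 4 by rewrite divr_gt0.
  have /cvgrPdist_lt/(_ _ r4) := @cvg_harmonic R; apply: filterS => m.
  by rewrite /harmonic /= sub0r normrN ger0_norm.
have := lip _ pu; have := lip _ (pv (phi n)).
have /ltr_normlP[? ?] := lt_trans phn nr.
move=> /ler_normlP[? ?] /ler_normlP[? ?].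
by apply/ltr_normlP; split; lra.
Unshelve. all: by end_near. Qed.

Variables (a q q' c : R).
Hypotheses (a0 : 0 < a) (q'0 : 0 < q') (q'q : q' < q) (aq1 : a * q < 1) (q1 : q < 1).
Hypothesis c0 : 0 < c.

(* The mass that escapes to infinitely small scales in the limit is seen only
   by a null set of points: this is what makes [charged c] stable under
   increasing unions with no loss in the constant [c]. *)
Lemma charged_bigcup (A : nat -> set Z) : (forall m n, (m <= n)%N -> A m `<=` A n) ->
  (forall n, charged a q' c (A n)) -> charged a q' c (\bigcup_n A n).
Proof.
move=> Amono /choice[v0 /choice[N vN]].
have q0 : 0 < q by exact: lt_trans q'q.
have pv0 m : packing c (v0 m) by have [] := vN m.
have [phi [u [phin pu vu]]] := packing_compact c0 pv0.
pose v n := v0 (phi n).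
pose N0 := \bigcup_n N n.
have nN0 : null q' N0 by apply: null_bigcup => [|k _]; [exact: countableP|have [] := vN k].
have vA m x : A m x -> ~ N0 x -> forall l, (m <= l)%N -> potential_ge1 a (v l) x.
  move=> Amx nN l ml; have [_ _] := vN (phi l); apply.
    exact: (Amono _ _ (leq_trans ml (phin l))).
  by move=> ?; apply: nN; exists (phi l).
(* The points lost in the limit: the approximations reach 1 from index [m] on, but the limit stays
   short of 1 by [rad k]. Countably many such sets suffice. *)
pose E k m := [set x | (forall l, (m <= l)%N -> potential_ge1 a (v l) x) /\
   forall n, potential a u n x <= 1 - rad k].
suff nE k m : null q' (E k m).
  exists u, (N0 `|` \bigcup_k \bigcup_m E k m); split => //.
    apply: nullU => //; apply: null_bigcup => [|k _]; first exact: countableP.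
    by apply: null_bigcup => [|m _]; first exact: countableP.
  move=> x [m _ Amx] /not_orP[nN0x nEx] t t1.
  apply: contrapT => nt; apply: nEx.
  have [k kt] : exists k, rad k < 1 - t by apply: rad_small; rewrite subr_gt0.
  exists k => //; exists m => //; split; first by move=> l; exact: vA.
  move=> n; have : potential a u n x <= t by rewrite leNgt; apply/negP => ?; apply: nt; exists n.
  by move: kt; lra.
(* Either the limit has terms of size q^j at infinitely many scales, which [good_null] handles, or
   its terms are small from some scale [i] on, which is the situation of [bad_null]. *)
pose G := [set x | forall i, exists2 j, (i <= j)%N & q ^+ j <= u j x].
pose B i := [set x | E k m x /\ forall j, (i <= j)%N -> u j x <= q ^+ j].
apply: (@null_sub _ _ _ _ (G `|` \bigcup_i B i)).
  move=> x Ex; have [Gx|] := pselect (G x); first by left.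
  move=> /existsNP[i ni]; right; exists i => //; split => // j ij.
  rewrite leNgt; apply/negP => uj; apply: ni; exists j => //; exact: ltW.
apply: nullU; first by apply: (@good_null _ _ sepZ q q' q'0 q'q c _ u) => // x; exact.
apply: null_bigcup => [|i _]; first exact: countableP.
apply: (null_le (q := q)) => //; [exact: ltW|exact: ltW|].
pose t := 4 / q ^+ 3.
have t0 : 0 < t by rewrite divr_gt0// exprn_gt0.
have aq0 : 0 < a * q by exact: mulr_gt0.
have [n0 n0P] : exists n0, (i.+3 <= n0)%N /\ t * (a * q) ^+ n0 <= rad k.+1 * (1 - a * q).
  have e0 : 0 < rad k.+1 * (1 - a * q) / t.
    by rewrite divr_gt0// mulr_gt0 ?rad_gt0// subr_gt0.
  have := @cvg_expr R (a * q); rewrite ger0_norm ?(ltW aq0)// => /(_ aq1).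
  move=> /cvgrPdist_lt/(_ _ e0)[n _ /(_ (maxn n i.+3))]/=.
  rewrite leq_maxl sub0r normrN ger0_norm ?exprn_ge0 ?(ltW aq0)// => /(_ isT) H.
  exists (maxn n i.+3); split; first exact: leq_maxr.
  by rewrite mulrC -ler_pdivlMr// ltW.
pose D m1 := [set x | B i x /\ forall l, (m1 <= l)%N ->
   exists2 j, (i.+3 <= j)%N & t * q ^+ j <= v l j x].
apply: (@null_sub _ _ _ _ (\bigcup_m1 D m1)); last first.
  apply: null_bigcup => [|m1 _]; first exact: countableP.
  apply: (@bad_null _ _ sepZ q q' q'0 q'q q1 c t _ v u i m1) => //.
  - by move=> l; exact: pv0.
  - by rewrite /t divfK// gt_eqF// exprn_gt0.
  - by move=> x [_ +]; exact.
  - by move=> x [[_ +] _]; exact.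
move=> x Bx; have [[Ex1 Ex2] _] := Bx.
have potv : potential a (v l) n0 x @[l --> \oo] --> potential a u n0 x.
  apply: cvg_sumR => j; apply: cvgM; [exact: cvg_cst|exact: vu].
have r4 : 0 < rad (R:=R) k.+2 by exact: rad_gt0.
have /cvgrPdist_le/(_ _ r4)[m1 _ m1P] := potv.
exists (maxn m m1) => //; split => // l; rewrite geq_max => /andP[ml m1l].
(* The first [n0] terms of [v l] sum to at most 1 - rad k + rad (k+2), while some partial potential
   exceeds 1 - rad (k+2). The gap rad k - 2 rad (k+2) = rad (k+1) must lie in the tail beyond [n0],
   which therefore contains a term of size t q^j. *)
have [n] := Ex1 _ ml (1 - rad k.+2) ltac:(by rewrite gtrDl oppr_lt0).
have /ler_normlP[+ _] := m1P l m1l.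
have [_ [v_ge0 _ _ _]] : True /\ packing c (v l) by split => //; exact: pv0.
have [nn0|/ltnW n0n] := leqP n n0.
  have : potential a (v l) n x <= potential a (v l) n0 x.
    rewrite /potential (big_cat_nat (leq0n n) nn0) /= lerDl; apply: sumr_ge0 => j _.
    by rewrite mulr_ge0// exprn_ge0// ltW.
  have := Ex2 n0; have := radS (R:=R) k; have := radS (R:=R) k.+1; lra.
rewrite [potential _ _ n _]/potential (big_cat_nat (leq0n n0) n0n)/= => H1 H2.
have : rad k.+1 < \sum_(n0 <= j < n) a ^+ j * v l j x.
  move: H1 H2; have := Ex2 n0; have := radS (R:=R) k; have := radS (R:=R) k.+1.
  by rewrite /potential; lra.
move=> /(exists_large_term (ltW a0) q0 aq1 (ltW t0) n0P.2)[j n0j jP].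
by exists j => //; exact: leq_trans n0P.1 n0j.
Qed.

End limits.

(** * Greedy points *)

Section greedy.
Context {R : realType} {Z : completeMetricType R}.
Hypothesis sepZ : separable Z.
Variables (a q q' c : R).
Hypotheses (a0 : 0 < a) (q'0 : 0 < q') (q'q : q' < q) (aq1 : a * q < 1) (q1 : q < 1).
Hypothesis c0 : 0 < c.

(* Comparable to [mdist x y `^ (- s)] for [a = 2 `^ s], truncated at scale [rad N]. *)
Definition riesz N (x y : Z) : R := \sum_(0 <= j < N) a ^+ j * bump j (mdist x y).

Lemma riesz_sym N x y : riesz N x y = riesz N y x.
Proof. by rewrite /riesz metric_sym. Qed.

Lemma riesz_ge0 N x y : 0 <= riesz N x y.
Proof. by apply: sumr_ge0 => j _; rewrite mulr_ge0 ?bump_ge0// exprn_ge0// ltW. Qed.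

Lemma riesz_le N x y : riesz N x y <= \sum_(0 <= j < N) a ^+ j.
Proof. by apply: ler_sum => j _; rewrite ler_piMr ?bump_le1// exprn_ge0// ltW. Qed.

(** The denominator counts one point more than the list, which admits the empty list and keeps the
    mass at most [c]. *)
Lemma packing_empirical (T : Type) (f : T -> Z) (l : seq T) :
  packing c (fun j x => c / (size l).+1%:R * \sum_(y <- l) bump j (mdist x (f y))).
Proof.
have k0 : 0 <= c / (size l).+1%:R by rewrite divr_ge0// ltW.
have kl x : 0 <= x -> c / (size l).+1%:R * (x *+ size l) <= c * x.
  move=> x0; rewrite -[x *+ _]mulr_natr mulrCA [leRHS]mulrC ler_wpM2l// mulrAC.
  by rewrite ler_pdivrMr// ler_pM2l// ler_nat.
have sum_mean (L : seq (nat * Z)) : \sum_(p <- L)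
    (c / (size l).+1%:R * \sum_(y <- l) bump p.1 (mdist p.2 (f y))) =
    c / (size l).+1%:R * \sum_(y <- l) bumps L (f y).
  by rewrite -mulr_sumr exchange_big.
split.
- by move=> j x; rewrite mulr_ge0//; apply: sumr_ge0 => y _; exact: bump_ge0.
- move=> j x x'; have d0 : 0 <= 2 ^+ j.+1 * mdist x x'.
    by rewrite mulr_ge0 ?mdist_ge0 ?exprn_ge0.
  apply: (@le_trans _ _ (c / (size l).+1%:R *
      \sum_(y <- l) (bump j (mdist x' (f y)) + 2 ^+ j.+1 * mdist x x'))).
    apply: ler_wpM2l => //; apply: ler_sum => y _; apply: le_trans (bump_lip _ _ (mdist x' (f y))) _.
    rewrite lerD2l ler_pM2l ?exprn_gt0//; apply/ler_normlP.
    have := metric_triangle x' x (f y); have := metric_triangle x x' (f y).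
    by rewrite (metric_sym x' x) => ? ?; split; lra.
  rewrite big_split/= mulrDr lerD2l big_const_seq count_predT iter_addr addr0 -[leRHS]mulrA.
  exact: kl.
- move=> L L1; rewrite sum_mean.
  apply: (@le_trans _ _ (c / (size l).+1%:R * \sum_(y <- l) 1)).
    by apply: ler_wpM2l => //; apply: ler_sum => y _; exact: L1.
  by rewrite big_const_seq count_predT iter_addr addr0 -[leRHS]mulr1; exact: kl.
- move=> L j x Lx; rewrite sum_mean; apply: ler_wpM2l => //; apply: ler_sum => y _.
  exact: Lx.
Qed.

Lemma cell_index (T : metricType R) (x0 : T) : separable T ->
  exists idx : nat -> T -> nat, forall k x y, idx k x = idx k y -> mdist x y <= 2 * rad k.
Proof.
move=> /(dense_sequence x0)[e eP].
have /choice[idx idxP] (p : nat * T) : exists n, mdist p.2 (e n) < rad p.1.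
  by apply: eP; exact: rad_gt0.
exists (fun k x => idx (k, x)) => k x y xy.
have := idxP (k, x); have := idxP (k, y); rewrite /= -xy => ye xe.
by rewrite mulr_natl mulr2n; exact: mdist_tri_lt xe ye.
Qed.

Variables (S : completeMetricType R) (f : S -> Z) (idx : nat -> S -> nat).
Hypothesis nfS : ~ charged a q' c (range f).

(** The cuts [idx n s <= k] exhaust the current set as [k] grows, so by [charged_bigcup] they cannot
    all be charged. Since [c] is the same before and after a cut, the choice can be repeated at
    every level. *)
Lemma compact_tree : exists m : nat -> nat,
  forall n, ~ charged a q' c (f @` [set s | forall k, (k < n)%N -> (idx k s <= m k)%N]).
Proof.
have /choice[g gP] (p : set S * nat) : exists m : nat,
    ~ charged a q' c (f @` p.1) -> ~ charged a q' c (f @` (p.1 `&` [set s | (idx p.2 s <= m)%N])).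
  have [ch|nch] := pselect (charged a q' c (f @` p.1)); first by exists 0%N.
  apply: contrapT => nex; apply: nch.
  apply: (@charged_sub _ _ _ _ _ _ (\bigcup_n f @` (p.1 `&` [set s | (idx p.2 s <= n)%N]))).
    by move=> _ [s ps <-]; exists (idx p.2 s) => //; exists s => //; split => //=.
  apply: (charged_bigcup sepZ (q := q)) => //.
    by move=> m n mn _ [s [ps sm] <-]; exists s => //; split => //; exact: leq_trans mn.
  by move=> n; apply: contrapT => nc; apply: nex; exists n.
pose fix B n := if n is n'.+1 then B n' `&` [set s | (idx n' s <= g (B n', n'))%N] else setT.
exists (fun n => g (B n, n)) => n.
suff -> : [set s | forall k, (k < n)%N -> (idx k s <= g (B k, k))%N] = B n.
  by elim: n => [|n IH] //; exact: (gP (B n, n) IH).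
elim: n => [|n IH]; first by apply/seteqP; split.
apply/seteqP; split => s /=.
  move=> H; split; last by exact: (H n).
  by rewrite -IH => k kn; apply: (H k); exact: leqW.
rewrite -{1}IH => -[H1 H2] k; rewrite ltnS leq_eqVlt => /predU1P[->//|]; exact: H1.
Qed.

Lemma greedy_sequence (B : nat -> set S) : (forall n, ~ charged a q' c (f @` B n)) ->
  exists s : nat -> S, forall n, B n (s n) /\
    forall N, \sum_(i < n) riesz N (f (s n)) (f (s i)) <= n.+1%:R / c.
Proof.
move=> nB.
have /choice[g gP] (l : seq S) : exists x, B (size l) x /\
    forall N, \sum_(y <- l) riesz N (f x) (f y) <= (size l).+1%:R / c.
  pose u j x := c / (size l).+1%:R * \sum_(y <- l) bump j (mdist x (f y)).
  have pu : packing c u := packing_empirical f l.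
  have [x [Bx [t [t1 ut]]]] : exists x, B (size l) x /\ exists t, t < 1 /\
      forall n, potential a u n (f x) <= t.
    apply: contrapT => nex; apply: (nB (size l)).
    exists u, set0; split => //.
      by move=> e e0; exists set0; split => // L uL LW; case: L uL LW => [|p L _ /(_ p (mem_head _ _))//];
        rewrite big_nil ltW.
    move=> _ [x Bx <-] _ t t1; apply: contrapT => nt; apply: nex; exists x; split => //.
    exists t; split => // n; rewrite leNgt; apply/negP => ?; apply: nt; by exists n.
  exists x; split => // N; rewrite ler_pdivlMr// exchange_big/=.
  have sl : 0 < (size l).+1%:R :> R by [].
  have : potential a u N (f x) <= 1 by exact: le_trans (ut N) (ltW t1).
  have -> : potential a u N (f x) = c / (size l).+1%:R *
      \sum_(0 <= j < N) \sum_(y <- l) a ^+ j * bump j (mdist (f x) (f y)).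
    rewrite /potential mulr_sumr; apply: eq_bigr => j _.
    by rewrite /u mulrCA; congr (_ * _); rewrite mulr_sumr.
  by move: (\sum_(0 <= j < N) _) => K; rewrite mulrAC ler_pdivrMr// mul1r mulrC.
pose fix bld n := if n is n'.+1 then g (bld n') :: bld n' else [::].
have szb n : size (bld n) = n by elim: n => //= n ->.
have sumb n (F : S -> R) : \sum_(y <- bld n) F y = \sum_(i < n) F (g (bld i)).
  elim: n => [|n IH]; first by rewrite big_nil big_ord0.
  by rewrite /= big_cons big_ord_recr/= IH addrC.
exists (fun n => g (bld n)) => n; have [] := gP (bld n); rewrite szb => Bn H.
by split => // N; have := H N; rewrite sumb.
Qed.

(** By symmetry the off-diagonal part is twice a sum of terms at most (i + 1) / c; the diagonal
    costs at most the value of the truncated kernel at distance 0 for each point. *)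
Lemma greedy_energy (x : nat -> Z) N n :
  (forall n, \sum_(i < n) riesz N (x n) (x i) <= n.+1%:R / c) ->
  \sum_(i < n) \sum_(j < n) riesz N (x i) (x j) <=
  n%:R * n.+1%:R / c + n%:R * \sum_(0 <= j < N) a ^+ j.
Proof.
move=> H; elim: n => [|n IH]; first by rewrite big_ord0 !mul0r addr0.
rewrite big_ord_recr/= (eq_bigr (fun i : 'I_n => \sum_(j < n) riesz N (x i) (x j) + riesz N (x n) (x i))).
  rewrite big_split/= big_ord_recr/=.
  have := riesz_le N (x n) (x n); have := H n; move: IH.
  set K := \sum_(0 <= j < N) _; rewrite -!natr1.
  set A := \sum_(i < n) _; set S1 := \sum_(i < n) _; set k := riesz _ _ _.
  set r := n%:R => IH H1 H2.
  have -> : (r + 1) * (r + 1 + 1) / c + (r + 1) * K =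
    (r * (r + 1) / c + r * K) + (r + 1) / c + (r + 1) / c + K by field; rewrite gt_eqF.
  lra.
by move=> i _; rewrite big_ord_recr/= (riesz_sym N (x n)).
Qed.

End greedy.

(** * Asymptotic frequencies along an ultrafilter *)

Section density.
Context {R : realType} {S : Type}.
Variables (U : set_system nat) (UU : UltraFilter U) (Uoo : \oo `<=` U).
Variable s : nat -> S.
Implicit Types A B : set S.

Definition freq A (n : nat) : R := (\sum_(i < n.+1) \1_A (s i)) / n.+1%:R.

Lemma freq_itv A n : 0 <= freq A n <= 1.
Proof.
rewrite divr_ge0 ?sumr_ge0//= ler_pdivrMr// mul1r.
apply: (@le_trans _ _ (\sum_(i < n.+1) 1)); first by apply: ler_sum => i _; by rewrite indicE lern1 leq_b1.
by rewrite sumr_const card_ord.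
Qed.

(** For a free ultrafilter this is a finitely additive probability on all subsets of [S],
    independent of any finite part of the sequence. *)
Definition density A : R := ulim U (freq A).

Lemma freq_cvg A : freq A @ U --> density A.
Proof. exact: (@ulimP _ U UU _ 1 (freq_itv A)). Qed.

Lemma density_ge0 A : 0 <= density A.
Proof.
apply: (ler_cvg_to (cvg_cst 0) (@freq_cvg A)); apply: nearW => n.
by have /andP[] := freq_itv A n.
Qed.

Lemma densityU A B : A `&` B = set0 -> density (A `|` B) = density A + density B.
Proof.
move=> AB.
have H : freq A n + freq B n @[n --> U] --> density A + density B.
  by apply: cvgD; exact: freq_cvg.
rewrite -(cvg_lim _ H)//.
rewrite [LHS]/density /ulim.
suff -> : freq (A `|` B) = (fun n => freq A n + freq B n) by [].
apply/funext => n; rewrite /freq /= -mulrDl -big_split/=; congr (_ / _); apply: eq_bigr => i _.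
rewrite !indicE in_setU.
case: (boolP (s i \in A)) => [/set_mem sA|_]; case: (boolP (s i \in B)) => [/set_mem sB|_];
  rewrite ?addr0 ?add0r//.
by have : (A `&` B) (s i) by []; rewrite AB.
Qed.

Lemma density_tail A k : (forall i, (k <= i)%N -> A (s i)) -> density A = 1.
Proof.
move=> kA; rewrite /density /ulim; apply: cvg_lim => //.
suff H : freq A @ \oo --> (1 : R).
  by apply: cvg_trans H => X; exact: Uoo.
apply: (@squeeze_cvgr _ _ _ _ (fun n => 1 - k%:R * n.+1%:R^-1) (fun=> 1)); last 2 first.
- rewrite -[X in _ --> X]subr0; apply: cvgB; first exact: cvg_cst.
  rewrite -(mulr0 k%:R); apply: cvgM; [exact: cvg_cst|exact: cvg_harmonic].
- exact: cvg_cst.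
apply: nearW => n; have /andP[_ ->] := freq_itv A n; rewrite andbT.
rewrite lerBlDr -mulrDl ler_pdivlMr// mul1r.
apply: (@le_trans _ _ (\sum_(i < n.+1) (\1_A (s i) + ((i : nat) < k)%N%:R))).
  rewrite -[n.+1%:R](_ : \sum_(i < n.+1) 1 = _); last by rewrite sumr_const card_ord.
  apply: ler_sum => i _; rewrite indicE; have [ik|ki] := ltnP i k.
    by rewrite lerDr.
  by rewrite mem_set ?addr0//; exact: kA.
rewrite big_split/= lerD2l -natr_sum ler_nat.
have -> : (\sum_(i < n.+1) (i < k)%N = minn n.+1 k)%N.
  elim: (n.+1) => [|m IH]; first by rewrite big_ord0 min0n.
  by rewrite big_ord_recr/= IH; lia.
exact: geq_minr.
Qed.

End density.

(** * Coding a density by intervals *)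

Section coding.
Context {R : realType} {S : Type}.
Variables (nu : set S -> R) (idx : nat -> S -> nat) (m : nat -> nat).
Hypothesis nu_ge0 : forall A, 0 <= nu A.
Hypothesis nuU : forall A B, A `&` B = set0 -> nu (A `|` B) = nu A + nu B.
Hypothesis nuT : nu setT = 1.
Hypothesis num : forall k, nu [set s | (idx k s <= m k)%N] = 1.

(* Prefixes are stored in reverse order, the most recent index first. *)
Fixpoint cell (p : seq nat) : set S :=
  if p is i :: p' then cell p' `&` [set s | idx (size p') s = i] else setT.

Fixpoint left_end (p : seq nat) : R :=
  if p is i :: p' then left_end p' + \sum_(j < i) nu (cell (nat_of_ord j :: p')) else 0.

(** Intervals of length [nu (cell p)], with the children of [p] laid from left to right inside the
    interval of [p]; Lebesgue measure thereby reproduces [nu] on cells. *)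
Definition slot (p : seq nat) : set R :=
  [set t | left_end p <= t < left_end p + nu (cell p)].

Let nu_le A B : A `<=` B -> nu A <= nu B.
Proof.
move=> AB; rewrite (_ : B = A `|` (B `\` A)); last first.
  apply/seteqP; split => [x Bx|x [/AB//|[]//]].
  by have [Ax|nAx] := pselect (A x); [left|right].
by rewrite nuU ?lerDl// setDE setIC -setIA setICl setI0.
Qed.

Let nu0 : nu set0 = 0.
Proof. by have := nuU (setI0 set0); rewrite setU0; lra. Qed.

Let sum_lt (p : seq nat) n :
  \sum_(i < n) nu (cell (nat_of_ord i :: p)) = nu (cell p `&` [set s | (idx (size p) s < n)%N]).
Proof.
elim: n => [|n IH].
  rewrite big_ord0 (_ : _ `&` _ = set0) ?nu0// -subset0 => s [_] /=.
  by rewrite ltn0.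
rewrite big_ord_recr/= IH -nuU.
  congr nu; apply/seteqP; split => s /=.
    by move=> [[ps sn]|[ps sn]]; split => //; [exact: ltnW|rewrite sn].
  by move=> [ps]; rewrite ltnS leq_eqVlt => /predU1P[sn|sn]; [right|left].
by rewrite -subset0 => s [[_ /= +] [_ sn]]; rewrite sn ltnn.
Qed.

Let nu_gt k : nu [set s | (m k < idx k s)%N] = 0.
Proof.
have : nu ([set s | (idx k s <= m k)%N] `|` [set s | (m k < idx k s)%N]) <= 1.
  by rewrite -nuT; exact: nu_le.
rewrite nuU ?num; first by have := nu_ge0 [set s | (m k < idx k s)%N]; lra.
by rewrite -subset0 => s [/= sm]; rewrite ltnNge sm.
Qed.

(** Tightness does the work of countable additivity here: finitely many children carry the whole
    mass of [cell p], so their slots leave no gap in the slot of [p]. *)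
Let sum_all (p : seq nat) :
  \sum_(i < (m (size p)).+1) nu (cell (nat_of_ord i :: p)) = nu (cell p).
Proof.
rewrite sum_lt; apply/eqP; rewrite eq_le nu_le/=; last by move=> s [].
rewrite -[leRHS]addr0 -(nu_gt (size p)) -nuU; last first.
  by rewrite -subset0 => s [[_ /= +] sm]; rewrite ltnS leqNgt sm.
apply: nu_le => s ps; have [sm|sm] := leqP (idx (size p) s) (m (size p)).
  by left.
by right.
Qed.

Let cell_big p i : (m (size p) < i)%N -> nu (cell (i :: p)) = 0.
Proof.
move=> mi; apply/eqP; rewrite eq_le nu_ge0 andbT -(nu_gt (size p)).
by apply: nu_le => s [_ /= ->].
Qed.

Lemma right_end_le i p :
  left_end (i :: p) + nu (cell (i :: p)) <= left_end p + nu (cell p).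
Proof.
rewrite /= -addrA lerD2l.
by have := sum_lt p i.+1; rewrite big_ord_recr/= => ->; apply: nu_le => s [].
Qed.

Lemma slot_sub i p : slot (i :: p) `<=` slot p.
Proof.
move=> t /andP[lt tl]; apply/andP; split; last exact: lt_le_trans tl (right_end_le i p).
by apply: le_trans lt; rewrite /= lerDl sumr_ge0.
Qed.

Lemma slot_child p t : slot p t -> exists i, slot (i :: p) t.
Proof.
move=> /andP[pt tp].
have ex : exists i, t < left_end p + \sum_(j < i.+1) nu (cell (nat_of_ord j :: p)).
  by exists (m (size p)); rewrite sum_all.
case: (ex_minnP ex) => i ti imin; exists i; apply/andP; split => /=; last first.
  by rewrite -addrA; move: ti; rewrite big_ord_recr.
case: i ti imin => [|i] ti imin; first by rewrite big_ord0 addr0.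
by rewrite leNgt; apply/negP => /imin; rewrite ltnn.
Qed.

Lemma slot_uniq p i j t : slot (i :: p) t -> slot (j :: p) t -> i = j.
Proof.
have lt a b : slot (a :: p) t -> slot (b :: p) t -> (b <= a)%N.
  move=> /andP[_ ta] /andP[tb _]; rewrite leqNgt; apply/negP => ab.
  have := le_lt_trans tb ta; apply/negP; rewrite -leNgt /= -addrA lerD2l.
  have -> : \sum_(j0 < a) nu (cell (nat_of_ord j0 :: p)) + nu (cell (a :: p)) =
     \sum_(j0 < a.+1) nu (cell (nat_of_ord j0 :: p)) by rewrite big_ord_recr.
  by rewrite !sum_lt; apply: nu_le => s [? sa]; split => //=; exact: leq_trans ab.
by move=> si sj; apply/eqP; rewrite eqn_leq; apply/andP; split; apply: lt.
Qed.

Fixpoint prefix_code (t : R) (k : nat) : seq nat :=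
  if k is k'.+1 then xget 0%N [set i | slot (i :: prefix_code t k') t] :: prefix_code t k'
  else [::].

Lemma size_prefix_code t k : size (prefix_code t k) = k.
Proof. by elim: k => //= k ->. Qed.

Lemma prefix_code_slot t k : slot [::] t -> slot (prefix_code t k) t.
Proof.
by move=> t01; elim: k => //= k /slot_child ex; case: xgetP => [i _ //|]; case: ex => i /[swap] /(_ i).
Qed.

Lemma prefix_codeP t p : slot p t -> prefix_code t (size p) = p.
Proof.
elim: p => [|i p IH] // si; have sp := slot_sub si.
by rewrite /= (IH sp); congr cons; case: xgetP => [j _ sj|/(_ i)//]; exact: slot_uniq sj si.
Qed.

Fixpoint prefixes (k : nat) : seq (seq nat) :=
  if k is k'.+1 then [seq i :: p | i <- iota 0 (m k').+1, p <- prefixes k'] else [:: [::]].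

Lemma prefixes_uniq k : uniq (prefixes k).
Proof.
elim: k => //= k IH; apply: (allpairs_uniq (iota_uniq 0 (m k).+1) IH).
by move=> [i p] [j q] _ _ [-> ->].
Qed.

Lemma prefixes_size k p : p \in prefixes k -> size p = k.
Proof.
elim: k p => [|k IH] p; first by rewrite inE => /eqP ->.
by move=> /allpairsP[[i q] [_ /= /IH <- ->]].
Qed.

Lemma prefix_code_in t k : slot [::] t -> prefix_code t k \in prefixes k.
Proof.
move=> t01; elim: k => [|k IH]; first by rewrite inE.
have st := prefix_code_slot k.+1 t01.
move: st; rewrite [prefix_code t k.+1]/=; move: (xget _ _) => i st.
apply/allpairsP; exists (i, prefix_code t k); split => //.
rewrite mem_iota leq0n add0n ltnS /= leqNgt; apply/negP => mi.
have /andP[] := st; rewrite (@cell_big _ i); first by rewrite addr0 => /le_lt_trans/[apply]; rewrite ltxx.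
by rewrite size_prefix_code.
Qed.

Lemma cell_disjoint p p' s : size p = size p' -> cell p s -> cell p' s -> p = p'.
Proof.
elim: p p' => [|i p IH] [|j p'] //= [pp'] [ps si] [ps' sj].
by rewrite (IH p')// -si -sj pp'.
Qed.

Lemma slot_cell t k : slot [::] t -> 0 < nu (cell (prefix_code t k)).
Proof.
move=> /(prefix_code_slot k)/andP[lt tl]; have := le_lt_trans lt tl.
by rewrite ltrDl.
Qed.

End coding.

(** * Measurability *)

Section measurability.
Context {R : realType} d (T : measurableType d).
Implicit Types (M : metricType R).

Lemma measurable_mdist_lt M (g : T -> M) (r : R) (z : M) :
  (forall z, measurable_fun setT (fun t => mdist z (g t))) ->
  measurable [set t | mdist z (g t) < r].
Proof.
move=> mg; rewrite (_ : [set t | _] = setT `&` (fun t => mdist z (g t)) @^-1` `]-oo, r[).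
  by apply: (mg z) => //; exact: measurable_itv.
by rewrite setTI; apply/seteqP; split => t /=; rewrite in_itv.
Qed.

(** One has d(g, h) < r exactly when d(e, g) + d(e, h) < r for some point e of a dense sequence. *)
Lemma measurable_mdist2 M (x0 : M) (g h : T -> M) : separable M ->
  (forall z, measurable_fun setT (fun t => mdist z (g t))) ->
  (forall z, measurable_fun setT (fun t => mdist z (h t))) ->
  measurable_fun setT (fun t => mdist (g t) (h t)).
Proof.
move=> /(dense_sequence x0)[e eP] mg mh mD.
apply: (measurability _ (RGenInftyO.measurableE R)) => //.
move=> _ [_ [r ->] <-]; rewrite setTI.
have -> : (fun t => mdist (g t) (h t)) @^-1` `]-oo, r[ =
    \bigcup_n [set t | mdist (e n) (g t) + mdist (e n) (h t) < r].
  apply/seteqP; split => t /=; rewrite in_itv/=.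
    move=> ghr; have [|n en] := eP (g t) ((r - mdist (g t) (h t)) / 2).
      by rewrite divr_gt0// subr_gt0.
    exists n => //=; have := metric_triangle (e n) (g t) (h t).
    rewrite (metric_sym (e n) (g t)); move: en ghr.
    move: (mdist _ _) (mdist _ _) (mdist _ _) => a b c; lra.
  move=> [n _ /=]; have := metric_triangle (g t) (e n) (h t).
  rewrite (metric_sym (g t) (e n)).
  move: (mdist _ _) (mdist _ _) (mdist _ _) => a b c; lra.
apply: bigcup_measurable => n _.
have mgh : measurable_fun setT (fun t => mdist (e n) (g t) + mdist (e n) (h t)).
  exact: measurable_funD.
rewrite (_ : [set t | _] = setT `&` (fun t => mdist (e n) (g t) + mdist (e n) (h t)) @^-1` `]-oo, r[).
  by apply: mgh => //; exact: measurable_itv.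
by rewrite setTI; apply/seteqP; split => t /=; rewrite in_itv.
Qed.

(** Distances to fixed points stand in for a measurable structure on [M]: by separability an open
    set is a countable union of balls around a dense sequence. *)
Lemma measurable_mdist_borel M (x0 : M) (g : T -> M) : separable M ->
  (forall z, measurable_fun setT (fun t => mdist z (g t))) ->
  forall B, borel B -> measurable (g @^-1` B).
Proof.
move=> /(dense_sequence x0)[e eP] mg.
pose G := [set B : set M | measurable (g @^-1` B)].
suff H : @borel M `<=` G by exact: H.
apply: smallest_sub.
  split.
  - by rewrite /G /= preimage_set0.
  - move=> A; rewrite /G/= setTD => mA; rewrite -[_ @^-1` _]/(~` (g @^-1` A)).
    exact: measurableC.
  - by move=> F mF; rewrite /G/= preimage_bigcup; apply: bigcup_measurable => k _; exact: mF.
move=> V oV; rewrite /G/=.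
pose W (p : nat * nat) := [set y | mdist (e p.1) y < rad (R:=R) p.2].
have -> : g @^-1` V = \bigcup_(p in [set p | W p `<=` V]) g @^-1` (W p).
  apply/seteqP; split => [t Vt|t [p pV] /pV//].
  have /nbhs_ballP[r /= r0 rV] : nbhs (g t) V by exact: open_nbhs_nbhs.
  have [j jr] := rad_small r0.
  have [n en] := eP (g t) (rad j.+1) (rad_gt0 _).
  exists (n, j.+1); last by rewrite /W/= metric_sym.
  move=> y /= ny; apply: rV; rewrite ballEmdist/=.
  apply: le_lt_trans jr; rewrite radS mulr_natl mulr2n metric_sym.
  apply: (@mdist_tri_lt _ _ _ _ (e n)); rewrite metric_sym//.
  by rewrite metric_sym.
rewrite bigcup_mkcond; apply: countable_bigcupT_measurable => [|p]; first exact: countableP.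
by case: ifPn => _ //; exact: measurable_mdist_lt.
Qed.

Lemma measurable_fun_finite (I : eqType) (X : T -> I) (L : seq I) (g : I -> R) :
  uniq L -> (forall t, X t \in L) -> (forall p, measurable [set t | X t = p]) ->
  measurable_fun setT (fun t => g (X t)).
Proof.
move=> uL XL mX.
rewrite (_ : (fun t => g (X t)) = fun t => \sum_(p <- L) g p * \1_[set t | X t = p] t).
  by apply: measurable_sum => p; apply: measurable_funM.
apply/funext => t; rewrite (bigD1_seq (X t))//= indicE mem_set// mulr1.
rewrite big1 ?addr0// => p pX; rewrite indicE memNset ?mulr0//= => Xp.
by rewrite Xp eqxx in pX.
Qed.

Lemma integral_finite (mu : {measure set T -> \bar R}) (I : eqType) (X : T -> I)
    (L : seq I) (g : I -> R) :
  uniq L -> (forall t, X t \in L) -> (forall p, measurable [set t | X t = p]) ->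
  (forall p, 0 <= g p) ->
  (\int[mu]_t (g (X t))%:E = \sum_(p <- L) (g p)%:E * mu [set t | X t = p])%E.
Proof.
move=> uL XL mX g0.
rewrite (_ : (fun t => (g (X t))%:E) =
    fun t => (\sum_(p <- L) (g p)%:E * (\1_[set t | X t = p] t)%:E)%E).
  rewrite ge0_integral_sum//.
  - apply: eq_bigr => p _; rewrite ge0_integralZl_EFin//.
    + by rewrite integral_indic// setIT.
    + by apply/measurable_EFinP; by apply/measurable_indicP; exact: mX.
  - move=> p; apply: emeasurable_funM => //; apply/measurable_EFinP; by apply/measurable_indicP; exact: mX.
  - by move=> p t _; rewrite mule_ge0// lee_fin.
apply/funext => t; rewrite (bigD1_seq (X t))//= indicE mem_set// mule1.
rewrite big1 ?adde0// => p pX; rewrite indicE memNset ?mule0//= => Xp.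
by rewrite Xp eqxx in pX.
Qed.

End measurability.

Section unif.
Context {R : realType}.

Definition unif01 : set (measurableTypeR R) -> \bar R :=
  mrestr lebesgue_measure (measurable_itv `[0, 1[).

HB.instance Definition _ := Measure.on unif01.

Lemma unif01_itv (a b : R) : 0 <= a -> a <= b -> b <= 1 ->
  unif01 `[a, b[%classic = (b - a)%:E.
Proof.
move=> a0 ab b1; rewrite /unif01 /mrestr setIidl.
  rewrite lebesgue_measure_itv/= lte_fin; case: ltgtP ab => // -> _.
  by rewrite subrr.
by move=> t /=; rewrite !in_itv/= => /andP[at_ tb]; rewrite (le_trans a0 at_) (lt_le_trans tb).
Qed.

Lemma unif01_setT : unif01 setT = 1%E.
Proof.
rewrite /unif01 /mrestr setTI lebesgue_measure_itv/= lte_fin ltr01.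
by rewrite oppr0 adde0.
Qed.

HB.instance Definition _ := Measure_isProbability.Build _ _ _ unif01 unif01_setT.

End unif.

Section frostman.
Context {R : realType} {Z : completeMetricType R}.
Hypothesis sepZ : separable Z.
Variables (a q q' c : R).
Hypotheses (a0 : 0 < a) (q'0 : 0 < q') (q'q : q' < q) (aq1 : a * q < 1) (q1 : q < 1).
Hypothesis c0 : 0 < c.

Let kernel := @riesz R Z a.

Lemma riesz_lip N (x y x' y' : Z) : kernel N x y <=
  kernel N x' y' + (\sum_(0 <= j < N) a ^+ j * 2 ^+ j.+1) * (mdist x x' + mdist y y').
Proof.
rewrite /kernel /riesz mulr_suml -big_split/=; apply: ler_sum => j _.
rewrite -mulrA -mulrDr ler_wpM2l ?exprn_ge0 ?(ltW a0)//.
apply: le_trans (bump_lip j _ (mdist x' y')) _.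
rewrite lerD2l ler_pM2l ?exprn_gt0//; apply/ler_normlP.
have := metric_triangle x x' y; have := metric_triangle x' y' y.
have := metric_triangle x' x y'; have := metric_triangle x y y'.
rewrite (metric_sym x' x) (metric_sym y' y).
by move: (mdist x y) (mdist x' y') (mdist x x') (mdist y y') (mdist x y') (mdist x' y);
  split; lra.
Qed.

Variables (S : completeMetricType R) (f : S -> Z) (s : nat -> S).
Hypothesis energy_s : forall n N,
  \sum_(i < n) kernel N (f (s n)) (f (s i)) <= n.+1%:R / c.
Variables (U : set_system nat) (UU : UltraFilter U) (Uoo : \oo `<=` U).

Let nu : set S -> R := density U s.

(** Averaging over n + 1 points, the pairs contribute at most (n + 2) / ((n + 1) c) <= 2 / c, the
    diagonal at most 1 once n + 1 exceeds the bound of the truncated kernel, and the discretization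
    error of [K] another 1. *)
Lemma density_energy (I : eqType) (L : seq I) (Q : I -> set S) (K : I -> I -> R) N :
  uniq L -> (forall p p' y, p \in L -> p' \in L -> Q p y -> Q p' y -> p = p') ->
  (forall p p' y y', p \in L -> p' \in L -> Q p y -> Q p' y' ->
     K p p' <= kernel N (f y) (f y') + 1) ->
  \sum_(p <- L) \sum_(p' <- L) K p p' * (nu (Q p) * nu (Q p')) <= 2 / c + 2.
Proof.
move=> uL disj KL.
pose E n := \sum_(p <- L) \sum_(p' <- L) K p p' * (freq s (Q p) n * freq s (Q p') n).
have Ecvg : E n @[n --> U] --> \sum_(p <- L) \sum_(p' <- L) K p p' * (nu (Q p) * nu (Q p')).
  apply: cvg_sumR => p; apply: cvg_sumR => p'.
  apply: cvgM; first exact: cvg_cst.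
  by apply: cvgM; exact: freq_cvg.
have pointwise y y' : \sum_(p <- L) \sum_(p' <- L) K p p' * (\1_(Q p) y * \1_(Q p') y') <=
    kernel N (f y) (f y') + 1.
  have k1 : 0 <= kernel N (f y) (f y') + 1 by rewrite addr_ge0// riesz_ge0.
  have [[p pL py]|nop] := pselect (exists2 p, p \in L & Q p y); last first.
    rewrite big_seq big1// => p pL; rewrite big1// => p' _.
    by rewrite [\1_(Q p) y]indicE memNset ?mul0r ?mulr0// => py; apply: nop; exists p.
  have [[p' p'L py']|nop] := pselect (exists2 p, p \in L & Q p y'); last first.
    rewrite big1// => p2 _; rewrite big_seq big1// => p' p'L.
    by rewrite [\1_(Q p') y']indicE memNset ?mulr0// => py'; apply: nop; exists p'.
  rewrite (bigD1_seq p)//= [X in _ + X]big_seq_cond [X in _ + X]big1 ?addr0; last first.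
    move=> p2 /andP[p2L p2p]; rewrite big1// => p3 _.
    rewrite [\1_(Q p2) y]indicE memNset ?mul0r ?mulr0// => p2y.
    by move/eqP: p2p; apply; exact: (disj _ _ y).
  rewrite (bigD1_seq p')//= [X in _ + X]big_seq_cond [X in _ + X]big1 ?addr0; last first.
    move=> p2 /andP[p2L p2p]; rewrite [\1_(Q p2) y']indicE memNset ?mulr0// => p2y.
    by move/eqP: p2p; apply; exact: (disj _ _ y').
  by rewrite !indicE !mem_set// !mulr1; exact: KL.
pose KN := \sum_(0 <= j < N) a ^+ j.
apply: (ler_cvg_to Ecvg (cvg_cst _)).
have : \forall n \near \oo, KN <= n.+1%:R.
  near=> n; apply: (@le_trans _ _ n%:R); last by rewrite ler_nat.
  by near: n; exact: nbhs_infty_ger.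
move=> /Uoo; apply: filterS => n Kn.
have n0 : 0 < n.+1%:R :> R by [].
have -> : E n = (\sum_(i < n.+1) \sum_(j < n.+1) \sum_(p <- L) \sum_(p' <- L)
    K p p' * (\1_(Q p) (s i) * \1_(Q p') (s j))) / n.+1%:R ^+ 2.
  rewrite /E mulr_suml.
  under [RHS]eq_bigr do rewrite mulr_suml.
  under [RHS]eq_bigr do under eq_bigr do rewrite mulr_suml.
  under [RHS]eq_bigr do rewrite exchange_big/=.
  rewrite [RHS]exchange_big/=; apply: eq_bigr => p _.
  under [RHS]eq_bigr do under eq_bigr do rewrite mulr_suml.
  under [RHS]eq_bigr do rewrite exchange_big/=.
  rewrite [RHS]exchange_big/=; apply: eq_bigr => p' _.
  rewrite /freq mulf_div -expr2 mulrA.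
  rewrite big_distrl/= big_distrr/= big_distrl/=; apply: eq_bigr => i _.
  by rewrite big_distrr/= big_distrr/= big_distrl.
rewrite ler_pdivrMr ?exprn_gt0//.
apply: (@le_trans _ _ (\sum_(i < n.+1) \sum_(j < n.+1) (kernel N (f (s i)) (f (s j)) + 1))).
  by apply: ler_sum => i _; apply: ler_sum => j _; exact: pointwise.
under eq_bigr do rewrite big_split/=.
rewrite big_split/= !sumr_const !card_ord.
have := @greedy_energy R Z a c a0 c0 (f \o s) N n.+1 (fun n => energy_s n N).
rewrite -/KN -/kernel; move: (\sum_(i < n.+1) _) => E1 /= HE.
have -> : 1 *+ n.+1 *+ n.+1 = n.+1%:R ^+ 2 :> R by rewrite -mulr_natr expr2.
have nn : n.+1%:R * n.+2%:R / c <= n.+1%:R ^+ 2 * (2 / c).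
  rewrite expr2 -!mulrA ler_pM2l// [leRHS]mulrA ler_pM2r ?invr_gt0//.
  by rewrite -natrM ler_nat muln2 doubleS !ltnS -addnn leq_addr.
have : n.+1%:R * KN <= n.+1%:R ^+ 2 by rewrite expr2 ler_pM2l.
by move: HE nn; rewrite mulrDr mulrC; move: (n.+1%:R ^+ 2) => X; lra.
Unshelve. all: by end_near. Qed.

End frostman.

Section coding_law.
Context {R : realType} {S : Type}.
Variables (nu : set S -> R) (idx : nat -> S -> nat) (m : nat -> nat).
Hypothesis nu_ge0 : forall A, 0 <= nu A.
Hypothesis nuU : forall A B, A `&` B = set0 -> nu (A `|` B) = nu A + nu B.
Hypothesis nuT : nu setT = 1.
Hypothesis num : forall k, nu [set s | (idx k s <= m k)%N] = 1.

(** Sending parameters outside [0, 1) to 0 makes every code lie in the tree; these parameters have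
    measure 0 for [unif01]. *)
Let clamp (t : R) : R := if 0 <= t < 1 then t else 0.

Definition unif_code (k : nat) (t : measurableTypeR R) : seq nat :=
  prefix_code nu idx (clamp t) k.

Let slot_clamp t : slot nu idx [::] (clamp t).
Proof.
rewrite /slot/= nuT add0r /clamp; case: ifPn => // _.
by rewrite lexx ltr01.
Qed.

Lemma unif_code_cell k t : 0 < nu (cell idx (unif_code k t)).
Proof. exact: (slot_cell nu_ge0 nuU nuT num). Qed.

Lemma unif_code_in k t : unif_code k t \in prefixes m k.
Proof. exact: (prefix_code_in nu_ge0 nuU nuT num). Qed.

Let slot01 p : slot nu idx p `<=` `[0, 1[%classic.
Proof.
elim: p => [|i p IH] t; first by rewrite /slot/= nuT add0r in_itv.
by move=> /(slot_sub nu_ge0 nuU); exact: IH.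
Qed.

Let slotE p : slot nu idx p = `[left_end nu idx p, left_end nu idx p + nu (cell idx p)[%classic.
Proof. by apply/seteqP; split => t /=; rewrite in_itv. Qed.

Let fiber k p : size p = k ->
  [set t | unif_code k t = p] `&` `[0, 1[%classic = slot nu idx p.
Proof.
move=> pk; apply/seteqP; split => t /=.
  rewrite in_itv/= /unif_code => -[<- t01]; move: (slot_clamp t).
  by rewrite /clamp t01 => st; exact: (prefix_code_slot nu_ge0 nuU nuT num).
move=> st; have := slot01 st; rewrite /= in_itv/= => t01; split => //.
by rewrite /unif_code /clamp t01 -pk; exact: (prefix_codeP nu_ge0 nuU).
Qed.

Lemma measurable_unif_code k p : measurable [set t | unif_code k t = p].
Proof.
have [pk|pk] := eqVneq (size p) k; last first.
  rewrite (_ : [set _ | _] = set0)// -subset0 => t /= tp; move/eqP: pk; apply.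
  by rewrite -tp size_prefix_code.
rewrite (_ : [set _ | _] = slot nu idx p `|`
    (if prefix_code nu idx 0 k == p then ~` `[0, 1[%classic else set0)).
  apply: measurableU; first by rewrite slotE; exact: measurable_itv.
  by case: ifP => // _; apply: measurableC; exact: measurable_itv.
rewrite -(fiber pk); apply/seteqP; split => t /=.
  move=> tp; have [t01|t01] := boolP (0 <= t < 1); first by left; rewrite in_itv.
  right; rewrite -tp /unif_code /clamp (negbTE t01) eqxx /=.
  by rewrite in_itv/=; exact/negP.
move=> [[]//|]; case: eqP => // kp; rewrite /= in_itv/= => /negP/negbTE t01.
by rewrite /unif_code /clamp t01.
Qed.

Lemma unif01_code k p : size p = k ->
  unif01 [set t | unif_code k t = p] = (nu (cell idx p))%:E.
Proof.
move=> pk; transitivity (unif01 (slot nu idx p)).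
  by rewrite /unif01 /mrestr (fiber pk) setIidl//; exact: slot01.
rewrite slotE unif01_itv ?lerDl//; first by rewrite addrAC subrr add0r.
  elim: p {pk} => //= i p IH; apply: addr_ge0 => //; exact: sumr_ge0.
elim: p {pk} => [|i p IH]; first by rewrite /= nuT add0r.
exact: le_trans (right_end_le idx nu_ge0 nuU i p) IH.
Qed.

End coding_law.

(** * Random points of finite energy *)

Lemma cvg_mdist (R : realType) (M : metricType R) (x y : nat -> M) (a b : M) :
  x @ \oo --> a -> y @ \oo --> b -> mdist (x n) (y n) @[n --> \oo] --> mdist a b.
Proof.
move=> /metricType_numDomainType.cvgrPdist_lt xa /metricType_numDomainType.cvgrPdist_lt yb.
apply/cvgrPdist_lt => e e0; have e2 : 0 < e / 2 by rewrite divr_gt0.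
near=> n.
have : mdist a (x n) < e / 2 by near: n; exact: xa.
have : mdist b (y n) < e / 2 by near: n; exact: yb.
have := metric_triangle a (x n) b; have := metric_triangle (x n) (y n) b.
have := metric_triangle (x n) a (y n); have := metric_triangle a b (y n).
rewrite (metric_sym (y n) b) (metric_sym (x n) a).
move: (mdist a b) (mdist (x n) (y n)) (mdist a (x n)) (mdist b (y n)) (mdist a (y n))
  (mdist (x n) b) => ? ? ? ? ? ? *.
by apply/ltr_normlP; split; lra.
Unshelve. all: by end_near. Qed.

Lemma limn_einf_le (R : realType) (u : (\bar R)^nat) (M : \bar R) :
  (forall n, (u n <= M)%E) -> (limn_einf u <= M)%E.
Proof.
move=> uM; rewrite limn_einf_lim; apply: lime_le; first exact: is_cvg_einfs.
apply: nearW => n; apply: le_trans (uM n); apply: ereal_inf_lbound.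
by exists n => //=.
Qed.

Section frostman.
Context {R : realType} {Z : completeMetricType R}.
Variables (a c : R).
Hypotheses (a0 : 0 < a) (c0 : 0 < c).

Lemma cvg_riesz N (x y : nat -> Z) (x' y' : Z) : x @ \oo --> x' -> y @ \oo --> y' ->
  riesz a N (x n) (y n) @[n --> \oo] --> riesz a N x' y'.
Proof.
move=> xx yy; pose C := \sum_(0 <= j < N) a ^+ j * 2 ^+ j.+1.
pose D n := C * (mdist (x n) x' + mdist (y n) y').
have D0 : D n @[n --> \oo] --> (0 : R).
  have : D n @[n --> \oo] --> C * (mdist x' x' + mdist y' y').
    apply: cvgM; first exact: cvg_cst.
    by apply: cvgD; apply: cvg_mdist => //; exact: cvg_cst.
  by rewrite !mdistxx addr0 mulr0.
apply: (@squeeze_cvgr _ _ _ _ (fun n => riesz a N x' y' - D n) (fun n => riesz a N x' y' + D n)).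
- apply: nearW => n; apply/andP; split; last exact: riesz_lip.
  by rewrite lerBlDr /D (metric_sym (x n)) (metric_sym (y n)); exact: riesz_lip.
- by rewrite -[X in _ --> X]subr0; apply: cvgB => //; exact: cvg_cst.
- by rewrite -[X in _ --> X]addr0; apply: cvgD => //; exact: cvg_cst.
Qed.

Variables (S : completeMetricType R) (f : S -> Z) (s : nat -> S).
Hypothesis fC : continuous f.
Variables (idx : nat -> S -> nat) (m : nat -> nat).
Hypothesis idxS : forall k y y', idx k y = idx k y' -> mdist y y' <= 2 * rad k.
Hypothesis idxZ : forall k y y', idx k y = idx k y' -> mdist (f y) (f y') <= 2 * rad k.
Hypothesis sm : forall k i, (k < i)%N -> (idx k (s i) <= m k)%N.
Hypothesis energy_s : forall n N,
  \sum_(i < n) riesz a N (f (s n)) (f (s i)) <= n.+1%:R / c.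

(** The level-k code of a uniform parameter has the law of [nu] on cells, so the energy of the
    discretized points is a finite double sum, bounded by [density_energy]. The points picked in the
    cells converge by completeness of [S], their images by continuity of [f], and Fatou carries the
    bound to the limit. *)
Lemma random_point : exists phi : measurableTypeR R -> S,
  (forall z, measurable_fun setT (fun t => mdist z (f (phi t)))) /\
  forall N, (\int[unif01 \x unif01]_w (riesz a N (f (phi w.1)) (f (phi w.2)))%:E
    <= (2 / c + 2)%:E)%E.
Proof.
have [U [UU Uoo]] := free_ultra.
pose nu : set S -> R := density U s.
have nu_ge0 A : 0 <= nu A := density_ge0 UU s A.
have nuU A B : A `&` B = set0 -> nu (A `|` B) = nu A + nu B := @densityU _ _ _ UU s A B.
have nuT : nu setT = 1 by exact: (density_tail UU Uoo (k := 0%N)).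
have num k : nu [set s | (idx k s <= m k)%N] = 1.
  by apply: (density_tail UU Uoo (k := k.+1)) => i ki; exact: sm.
pose code := unif_code nu idx.
have nu0 : nu set0 = 0 by have := nuU _ _ (setI0 set0); rewrite setU0; lra.
pose pick p : S := xget point (cell idx p).
have pickP p y : cell idx p y -> cell idx p (pick p) by move=> py; exact: (xgetI _ py).
have codeP k t : cell idx (code k t) (pick (code k t)).
  have := unif_code_cell nu_ge0 nuU nuT num k t.
  have [->|/set0P[y /pickP//]] := eqVneq (cell idx (unif_code nu idx k t)) set0.
  by rewrite nu0 ltxx.
have cell_sub k l t y : (k <= l)%N -> cell idx (code l t) y -> cell idx (code k t) y.
  by move=> /subnK <-; elim: (l - k)%N => //= j IH [+ _]; exact: IH.
have cell_idx k t y y' : cell idx (code k.+1 t) y -> cell idx (code k.+1 t) y' ->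
    idx k y = idx k y'.
  by move=> [_ /= yE] [_ /= yE']; move: yE yE'; rewrite size_prefix_code => -> ->.
pose y k t := pick (code k t).
have ycvg t : y k t @[k --> \oo] --> lim (y k t @[k --> \oo]).
  apply: cauchy_cvg; apply: cauchy_exP => e e0.
  have [k ke] : exists k, rad k < e / 2 by apply: rad_small; rewrite divr_gt0.
  exists (y k.+1 t); exists k.+1 => // l /= kl; rewrite ballEmdist /=.
  apply: (@le_lt_trans _ _ (2 * rad k)); last by rewrite mulrC -ltr_pdivlMr.
  by apply: idxS; apply: (@cell_idx k t) => //; exact: (cell_sub k.+1 l).
pose phi t := lim (y k t @[k --> \oo]).
have fcvg t : f (y k t) @[k --> \oo] --> f (phi t).
  by apply: continuous_cvg; [exact: fC|exact: ycvg].
exists phi; split.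
  move=> z; apply: (@measurable_fun_cvg _ _ _ _ (fun k t => mdist z (f (y k t)))).
    move=> k; apply: (measurable_fun_finite (I := seq nat) (X := code k) (L := prefixes m k)
      (fun p => mdist z (f (pick p)))).
    - exact: prefixes_uniq.
    - by move=> t; exact: (unif_code_in nu_ge0 nuU nuT num).
    - by move=> p; exact: (measurable_unif_code nu_ge0 nuU nuT num).
  by move=> t _; apply: cvg_mdist => //; exact: cvg_cst.
move=> N; pose C := \sum_(0 <= j < N) a ^+ j * 2 ^+ j.+1.
have C0 : 0 <= C by apply: sumr_ge0 => j _; rewrite mulr_ge0// exprn_ge0// ltW.
have C1 : 0 < C + 1 by lra.
(* From this level on the images of cells have diameter at most 2 [rad k0], so moving both arguments
   within their cells changes the kernel by at most 1, the slack that [density_energy] grants. *)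
have [k0 k0P] : exists k0, C * (4 * rad k0) <= 1.
  have [k kP] : exists k, rad k < (4 * (C + 1))^-1.
    by apply: rad_small; rewrite invr_gt0 mulr_gt0.
  exists k.
  have := ltW kP; rewrite -[leRHS]mul1r ler_pdivlMr ?mulr_gt0//.
  have := rad_ge0 (R := R) k; move: (rad k) => r r0 H; nra.
pose g p p' := riesz a N (f (pick p)) (f (pick p')).
have g_ge0 p p' : 0 <= g p p' by exact: riesz_ge0.
pose F n (w : measurableTypeR R * measurableTypeR R) : \bar R :=
  (g (code (k0.+1 + n)%N w.1) (code (k0.+1 + n)%N w.2))%:E.
have mF n : measurable_fun setT (F n).
  apply/measurable_EFinP; pose k := (k0.+1 + n)%N.
  apply: (measurable_fun_finite (I := (seq nat * seq nat)%type)
    (X := fun w => (code k w.1, code k w.2))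
    (L := [seq (p, p') | p <- prefixes m k, p' <- prefixes m k])
    (fun p => g p.1 p.2)).
  - by apply: allpairs_uniq; [exact: prefixes_uniq|exact: prefixes_uniq|case=> ? ? []].
  - move=> w; apply/allpairsP; exists (code k w.1, code k w.2).
    by split => //; exact: (unif_code_in nu_ge0 nuU nuT num).
  - move=> [p p']; rewrite (_ : [set _ | _] = [set t | code k t = p] `*` [set t | code k t = p']).
      by apply: measurableX; exact: (measurable_unif_code nu_ge0 nuU nuT num).
    by apply/seteqP; split => [[t t'] /= [-> ->]|[t t'] /= [-> ->]].
have Fle n : (\int[unif01 \x unif01]_w F n w <= (2 / c + 2)%:E)%E.
  rewrite fubini_tonelli1//; last by move=> w; rewrite lee_fin.
  pose k := (k0.+1 + n)%N; pose L := prefixes m k.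
  pose h p := \sum_(p' <- L) g p p' * nu (cell idx p').
  have hE t : fubini_F unif01 (F n) t = (h (code k t))%:E.
    rewrite /fubini_F /F /= (integral_finite (L := L) (X := code k) unif01 (g := g (code k t)))//.
    - rewrite /h -sumEFin big_seq [RHS]big_seq; apply: eq_bigr => p /prefixes_size pk.
      by rewrite EFinM; congr (_ * _)%E; rewrite -(unif01_code nu_ge0 nuU nuT num pk).
    - exact: prefixes_uniq.
    - by move=> t'; exact: (unif_code_in nu_ge0 nuU nuT num).
    - by move=> p; exact: (measurable_unif_code nu_ge0 nuU nuT num).
  rewrite (eq_integral (fun t => (h (code k t))%:E)); last by move=> t _; exact: hE.
  rewrite (integral_finite (L := L) (X := code k) unif01 (g := h))//; last first.
  - by move=> p; apply: sumr_ge0 => p' _; rewrite mulr_ge0.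
  - by move=> p; exact: (measurable_unif_code nu_ge0 nuU nuT num).
  - by move=> t'; exact: (unif_code_in nu_ge0 nuU nuT num).
  - exact: prefixes_uniq.
  rewrite (_ : \sum_(p <- L) _ =
      (\sum_(p <- L) \sum_(p' <- L) g p p' * (nu (cell idx p) * nu (cell idx p')))%:E)%E.
    rewrite lee_fin; apply: (density_energy a0 c0 energy_s UU Uoo (N := N)).
    - exact: prefixes_uniq.
    - move=> p p' y0 /prefixes_size pk /prefixes_size pk'.
      by apply: cell_disjoint; rewrite pk.
    - move=> p p' y1 y2 /prefixes_size pk /prefixes_size pk' py1 py2.
      apply: le_trans (riesz_lip a0 N _ _ (f y1) (f y2)) _.
      rewrite lerD2l; apply: le_trans k0P; rewrite -/C ler_wpM2l//.
      have near q y0 : size q = k -> cell idx q y0 -> mdist (f (pick q)) (f y0) <= 2 * rad k0.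
        move=> qk qy; have kE : k = (k0 + n).+1 by [].
        case: q qk qy => [|i q]; first by rewrite kE.
        rewrite kE => -[qk] qy; have := pickP _ _ qy; move: qy => [_ /= yi] [_ /= pi].
        have : mdist (f (pick (i :: q))) (f y0) <= 2 * rad (k0 + n).
          by apply: idxZ; rewrite -qk yi pi.
        move/le_trans; apply; rewrite ler_pM2l//; apply: rad_le; exact: leq_addr.
      by have := near _ _ pk py1; have := near _ _ pk' py2; lra.
  rewrite -sumEFin big_seq [RHS]big_seq; apply: eq_bigr => p /prefixes_size pk.
  transitivity ((h p)%:E * (nu (cell idx p))%:E)%E.
    by congr (_ * _)%E; rewrite -(unif01_code nu_ge0 nuU nuT num pk).
  rewrite -EFinM /h mulr_suml; congr EFin.
  by apply: eq_bigr => p' _; rewrite mulrAC mulrA.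
have Flim w : limn_einf (F^~ w) = (riesz a N (f (phi w.1)) (f (phi w.2)))%:E.
  have H : F n w @[n --> \oo] --> (riesz a N (f (phi w.1)) (f (phi w.2)))%:E.
    apply: cvg_EFin; first by apply: nearW.
    have := @cvg_riesz N _ _ _ _ (fcvg w.1) (fcvg w.2).
    rewrite -(cvg_shiftn k0.+1); apply: cvg_trans; apply: near_eq_cvg; apply: nearW => n.
    by rewrite /= /g /y addnC.
  by have [-> _] := cvg_limn_einf_sup H.
under eq_integral do rewrite -Flim.
apply: le_trans (limn_einf_le Fle); apply: fatou => // n w _.
by rewrite lee_fin.
Qed.

End frostman.

Lemma rad_powR (R : realType) (s : R) j : rad j `^ s = (2 `^ (- s)) ^+ j.
Proof.
rewrite -powR_mulrn ?powR_ge0// -powRrM /rad -powR_mulrn ?invr_ge0// -powR_inv1//.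
by rewrite -!powRrM; congr powR; ring.
Qed.

(** * Null sets and Hausdorff measure *)

Section hausdorff_null.
Context {R : realType} {Z : completeMetricType R}.
Implicit Types A : set Z.

Lemma hausdorff_null (s : R) A : 0 < s -> null (2 `^ (- s)) A ->
  hausdorff_measure s A = 0%E.
Proof.
move=> s0 nA; apply/eqP; rewrite eq_le; apply/andP; split; last first.
  apply: le_trans (ereal_sup_ubound _); last by exists 1 => //=.
  apply: le_ereal_inf_tmp => _ [E _ <-]; apply: nneseries_ge0 => n _ _.
  by rewrite /hausdorff_weight; case: ifP => // _; exact: poweR_ge0.
apply: ge_ereal_sup => _ [dl /= dl0 <-]; apply/lee_addgt0Pr => e e0; rewrite add0e.
(* Each term is at most the whole sum, so the first bound forces all radii to be at most dl / 4. The
   second pays for the factor 4^s, as a ball of radius 2 r has diameter at most 4 r. *)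
pose eps := Num.min ((dl / 4) `^ s) (e / 4 `^ s).
have p4 : 0 < 4 `^ s :> R by exact: powR_gt0.
have [|W [/countable_injP[h hI] AW We]] := nA eps.
  by rewrite lt_min powR_gt0 ?divr_gt0//=.
have small p : W p -> rad p.1 <= dl / 4.
  move=> Wp; rewrite leNgt; apply/negP => rp.
  have : (2 `^ (- s)) ^+ p.1 <= eps.
    by have := We [:: p] isT; rewrite big_seq1; apply => i; rewrite inE => /eqP ->.
  rewrite -rad_powR le_min => /andP[+ _]; rewrite leNgt => /negP; apply.
  by apply: gt0_ltr_powR => //; rewrite nnegrE ?rad_ge0// divr_ge0// ltW.
have /choice[opt optP] (n : nat) : exists o : option (nat * Z),
    (forall p, o = Some p <-> W p /\ h p = n).
  have [[p [Wp hp]]|no] := pselect (exists p, W p /\ h p = n).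
    exists (Some p) => p'; split => [[<-]//|[Wp' hp']]; congr Some.
    by apply: hI; rewrite ?inE// hp hp'.
  by exists None => p; split => // -[Wp hp]; exfalso; apply: no; exists p.
pose B (p : nat * Z) := [set x | mdist p.2 x <= 2 * rad p.1].
have diamB p : (diameter (B p) <= (4 * rad p.1)%:E)%E.
  apply: ge_ereal_sup => _ [x px [y py <-]]; rewrite lee_fin.
  have := metric_triangle x p.2 y; rewrite (metric_sym x p.2) => H; apply: le_trans H _.
  by move: px py; rewrite /B/=; lra.
pose E n := if opt n is Some p then B p else set0.
apply: (@le_trans _ _ (\sum_(0 <= i <oo) hausdorff_weight s (E i))%E).
  apply: ereal_inf_lbound; exists E => //; split.
    move=> x /AW[p Wp px]; exists (h p) => //; rewrite /E.
    by have /(optP (h p) p) -> : W p /\ h p = h p by [].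
  move=> n; rewrite /E; case onE : (opt n) => [p|].
    have [Wp _] := (optP n p).1 onE; apply: le_trans (diamB p) _.
    by rewrite lee_fin mulrC -ler_pdivlMr//; exact: small.
  by apply: ge_ereal_sup => _ [x []].
have weight0 n : (0 <= hausdorff_weight s (E n))%E.
  by rewrite /hausdorff_weight; case: ifP => // _; exact: poweR_ge0.
apply: lime_le; first by apply: is_cvg_nneseries => n _ _.
apply: nearW => N.
pose L := pmap opt (iota 0 N).
have uL : uniq L.
  apply: (pmap_uniq (g := h)); last exact: iota_uniq.
  by move=> n /=; case onE : (opt n) => [p|//]; have [_] := (optP n p).1 onE.
have LW p : p \in L -> W p.
  by rewrite mem_pmap => /mapP[n _ /esym/(optP n p)[]].
apply: (@le_trans _ _ (4 `^ s * \sum_(p <- L) (2 `^ (- s)) ^+ p.1)%:E); last first.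
  rewrite lee_fin -ler_pdivlMl// mulrC; apply: le_trans (We L uL LW) _.
  by rewrite ge_min lexx orbT.
rewrite /L big_pmap mulr_sumr -sumEFin /index_iota subn0; apply: lee_sum => n _.
rewrite /E; case onE : (opt n) => [p|] /=; last by rewrite /hausdorff_weight eqxx mulr0.
rewrite /hausdorff_weight; case: ifPn => [_|B0].
  by rewrite lee_fin mulr_ge0 ?exprn_ge0 ?powR_ge0.
rewrite -rad_powR -powRM ?rad_ge0// -poweR_EFin.
have /set0P[x Bx] := B0.
have d0 : (0 <= diameter (B p))%E.
  by apply: ereal_sup_ubound; exists x => //; exists x => //; rewrite mdistxx.
apply: (gt0_ler_poweR (ltW s0)); last exact: diamB.
  by rewrite in_itv/= d0 leey.
by rewrite in_itv/= lee_fin mulr_ge0 ?rad_ge0// leey.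
Qed.

End hausdorff_null.

Lemma frostman (R : realType) (Z : completeMetricType R) (sepZ : separable Z)
  (X : set Z) (anaX : analytic R X) (s : R) (s0 : 0 < s) (dimX : (s%:E < hausdorff_dim X)%E) :
  exists (xi : measurableTypeR R -> X) (M : R),
    (forall z, measurable_fun setT (fun t => mdist z (set_val (xi t)))) /\
    forall N, (\int[unif01 \x unif01]_w
      (riesz (2 `^ s) N (set_val (xi w.1)) (set_val (xi w.2)))%:E <= M%:E)%E.
Proof.
have [_ [s2 [s2_ge0 HX] <-]] := ereal_sup_gt dimX; rewrite lte_fin => ss2.
have s2_gt0 : 0 < s2 by exact: lt_trans ss2.
pose s1 := (s + s2) / 2.
have ss1 : s < s1 by rewrite /s1; lra.
have s1s2 : s1 < s2 by rewrite /s1; lra.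
pose a : R := 2 `^ s; pose q : R := 2 `^ (- s1); pose q' : R := 2 `^ (- s2).
have pow_lt (x y : R) : x < y -> 2 `^ x < 2 `^ y :> R.
  by move=> xy; rewrite /powR pnatr_eq0/= ltr_expR ltr_pM2r// ln_gt0// ltr1n.
have a0 : 0 < a by exact: powR_gt0.
have q'0 : 0 < q' by exact: powR_gt0.
have q'q : q' < q by apply: pow_lt; rewrite ltrN2.
have pow0 : 2 `^ 0 = 1 :> R by exact: powRr0.
have aq1 : a * q < 1.
  by rewrite /a /q -powRD ?pnatr_eq0 ?implybT// -[ltRHS]pow0; apply: pow_lt; rewrite subr_lt0.
have q1 : q < 1 by rewrite -[ltRHS]pow0; apply: pow_lt; rewrite oppr_lt0 (lt_trans s0).
have nX : ~ null q' X.
  by move=> /(hausdorff_null s2_gt0) H0; rewrite H0 ltxx in HX.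
have [c [c0 ncX]] : exists c, 0 < c /\ ~ charged a q' c X.
  apply: contrapT => nex; apply: nX; apply: (charged_null sepZ (q := q) a0) => // c c0.
  by apply: contrapT => nc; apply: nex; exists c.
case: anaX => [X0|[S [sepS [f fC XE]]]].
  exfalso; apply: nX => e e0; exists set0; split => //; first by rewrite X0 => x [].
  by move=> [|p L] _ LW; [rewrite big_nil ltW|have := LW p (mem_head _ _)].
have [iS iSP] := cell_index point sepS.
have [iZ iZP] := cell_index point sepZ.
(* One index controls two diameters: cells small in [S] make the picked points converge, and cells
   with small image in [Z] control the kernel, as [f] may fail to be uniformly continuous. *)
pose idx k y := pickle (iS k y, iZ k (f y)).
have idxE k y y' : idx k y = idx k y' -> iS k y = iS k y' /\ iZ k (f y) = iZ k (f y').
  by move=> /(pcan_inj pickleK)[].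
have ncf : ~ charged a q' c (range f) by rewrite -XE.
have [m mP] := compact_tree sepZ a0 q'0 q'q aq1 q1 c0 idx ncf.
have [pts ptsP] := greedy_sequence c0 mP.
have [phi [mphi phiE]] := @random_point R Z a c a0 c0 S f pts fC idx m
  (fun k y y' H => iSP k y y' (idxE k y y' H).1)
  (fun k y y' H => iZP k (f y) (f y') (idxE k y y' H).2)
  (fun k i ki => (ptsP i).1 k ki) (fun n N => (ptsP n).2 N).
have Xf t : X (f (phi t)) by rewrite XE; exists (phi t).
exists (fun t => SigSub (mem_set (Xf t))), (2 / c + 2).
by split.
Qed.

(** * Projections *)

Section measurable_more.
Context {R : realType} d (T : measurableType d).

Lemma measurable_mdist_ball (M : metricType R) (g : T -> M) (z : M) :
  (forall r : R, measurable [set t | mdist z (g t) < r]) ->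
  measurable_fun setT (fun t => mdist z (g t)).
Proof.
move=> mg mD; apply: (measurability _ (RGenInftyO.measurableE R)) => //.
move=> _ [_ [r ->] <-]; rewrite setTI.
rewrite (_ : _ @^-1` _ = [set t | mdist z (g t) < r]); first exact: mg.
by apply/seteqP; split => t /=; rewrite in_itv.
Qed.

Lemma measurable_mdist_le (M : metricType R) (g h : T -> M) (r : R) :
  measurable_fun setT (fun t => mdist (g t) (h t)) ->
  measurable [set t | mdist (g t) (h t) <= r].
Proof.
move=> mg; rewrite (_ : [set t | _] = setT `&` (fun t => mdist (g t) (h t)) @^-1` `]-oo, r]).
  by apply: mg => //; exact: measurable_itv.
by rewrite setTI; apply/seteqP; split => t /=; rewrite in_itv.
Qed.

Lemma measurable_fun_limn_einf (f : (T -> \bar R)^nat) :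
  (forall n, measurable_fun setT (f n)) ->
  measurable_fun setT (fun x => limn_einf (f ^~ x)).
Proof.
move=> mf; rewrite (_ : (fun x => _) =
    fun x => (- limn_esup (fun n => - f n x))%E); last first.
  apply/funext => x; rewrite -[RHS]limn_einfN; congr limn_einf.
  by apply/funext => n /=; rewrite oppeK.
apply: (measurableT_comp (f := -%E)); first exact: oppe_measurable.
apply: (@measurable_fun_limn_esup _ _ _ _ (fun n x => - f n x)%E) => n.
by apply: (measurableT_comp (f := -%E)) => //; exact: oppe_measurable.
Qed.

End measurable_more.

Lemma measurable_section (R : realType) (Z : completeMetricType R)
  (X : set Z) (Y : pointedMetricType R) d (L : measurableType d)
  (proj : L -> X -> Y) d' (T : measurableType d') (xi : T -> X) :
  separable Z -> jointly_measurable proj ->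
  (forall z, measurable_fun setT (fun t => mdist z (set_val (xi t)))) ->
  forall y, measurable_fun setT (fun w : L * T => mdist y (proj w.1 (xi w.2))).
Proof.
move=> sepZ mproj mxi y; apply: measurable_mdist_ball => r.
have mX (V : set X) : @borel X V -> measurable (xi @^-1` V).
  pose G := [set V : set X | measurable (xi @^-1` V)].
  suff H : @borel X `<=` G by exact: H.
  apply: smallest_sub.
    split.
    - by rewrite /G /= preimage_set0.
    - move=> A; rewrite /G/= setTD => mA; rewrite -[_ @^-1` _]/(~` (xi @^-1` A)).
      exact: measurableC.
    - by move=> F mF; rewrite /G/= preimage_bigcup; apply: bigcup_measurable => k _; exact: mF.
  move=> _ [W oW <-]; rewrite /G/=.
  have bW : @borel Z W by exact: sub_sigma_algebra.
  exact: (measurable_mdist_borel point sepZ mxi bW).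
pose h (w : L * T) : L * X := (w.1, xi w.2).
pose G := [set V : set (L * X) | measurable (h @^-1` V)].
have : G [set lx : L * X | [set z | mdist y z < r] (proj lx.1 lx.2)].
  have sub : <<s [set A `*` U | A in @measurable d L & U in @borel X] >> `<=` G.
    apply: smallest_sub.
      split.
      - by rewrite /G /= preimage_set0.
      - move=> A; rewrite /G/= setTD => mA; rewrite -[_ @^-1` _]/(~` (h @^-1` A)).
        exact: measurableC.
      - by move=> F mF; rewrite /G/= preimage_bigcup; apply: bigcup_measurable => k _; exact: mF.
    move=> _ [A mA [V bV <-]]; rewrite /G/=.
    rewrite (_ : h @^-1` _ = A `*` (xi @^-1` V)); last by apply/seteqP; split => [[? ?]|[? ?]].
    by apply: measurableX => //; exact: mX.
  apply: sub; apply: mproj; apply: sub_sigma_algebra; exact: open_mdist_lt.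
by [].
Qed.

Section riesz_lower.
Context {R : realType} {Z : completeMetricType R}.
Variables (s : R).
Hypothesis s0 : 0 < s.

Let a : R := 2 `^ s.

Let a1 : 1 < a.
Proof. by rewrite /a /powR pnatr_eq0/= -[ltLHS]expR0 ltr_expR mulr_gt0// ln_gt0// ltr1n. Qed.

Let a0 : 0 < a. Proof. exact: lt_trans a1. Qed.

(** For rad (j+2) < d <= rad (j+1) the j-th bump is 1, so the kernel is at least a^j while d^-s <=
    a^(j+2); hence a^2. The added 1 covers d > 1/4, and the first alternative covers distances below
    the truncation scale, 0 included. *)
Lemma riesz_lower (B : R) : exists N, forall x y : Z,
  B <= a ^+ 2 * (riesz a N x y + 1) \/
  0 < mdist x y /\ mdist x y `^ (- s) <= a ^+ 2 * (riesz a N x y + 1).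
Proof.
have [n nB] : exists n, B <= a ^+ n.
  have r1 : a^-1 < 1 by rewrite invf_lt1.
  have ri : 0 <= a^-1 by rewrite invr_ge0 ltW.
  have [B0|B0] := leP B 0; first by exists 0%N; rewrite (le_trans B0).
  have := @cvg_expr R a^-1; rewrite ger0_norm// => /(_ r1).
  have Bi : 0 < B^-1 by rewrite invr_gt0.
  move=> /cvgrPdist_lt/(_ _ Bi)[n _ /(_ n (leqnn n))]/=.
  rewrite sub0r normrN ger0_norm ?exprn_ge0// exprVn ltf_pV2 ?posrE ?exprn_gt0//.
  by exists n; exact: ltW.
exists n.+1 => x y; set dx := mdist x y.
have term j : (j <= n)%N -> dx <= rad j.+1 -> a ^+ j <= riesz a n.+1 x y.
  move=> jn dj; rewrite /riesz (bigD1_seq j) ?iota_uniq ?mem_index_iota//=.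
  rewrite -/dx (bump_eq1 dj) mulr1 lerDl; apply: sumr_ge0 => i _.
  by rewrite mulr_ge0 ?bump_ge0// exprn_ge0// ltW.
have k0 : 0 <= riesz a n.+1 x y := riesz_ge0 a0 _ _ _.
have a2 : 1 <= a ^+ 2 by rewrite exprn_ege1// ltW.
have [dn|dn] := leP dx (rad n.+1).
  left; apply: le_trans nB _; apply: le_trans (term n (leqnn n) dn) _.
  by move: (riesz _ _ _ _) k0 => K K0; nra.
right; have dx0 : 0 < dx by apply: le_lt_trans dn; exact: rad_ge0.
split => //.
have ex : exists j, rad j.+2 < dx.
  by exists n; apply: le_lt_trans dn; exact: rad_le.
case: (ex_minnP ex) => j jd jmin.
have jn : (j <= n)%N by apply: jmin; apply: le_lt_trans dn; exact: rad_le.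
have powd : dx `^ (- s) <= a ^+ j.+2.
  rewrite powRN -[leRHS]invrK lef_pV2 ?posrE ?powR_gt0 ?invr_gt0 ?exprn_gt0//.
  rewrite -exprVn (_ : a^-1 = 2 `^ (- s)); last by rewrite powRN.
  by rewrite -rad_powR; apply: ge0_ler_powR; rewrite ?nnegrE ?rad_ge0 ?(ltW s0)// ltW.
apply: le_trans powd _; rewrite -addn2 exprD mulrC ler_pM2l ?exprn_gt0//.
case: j jn jd jmin => [|j] jn jd jmin; first by rewrite expr0 lerDr.
have dj : dx <= rad j.+2 by rewrite leNgt; apply/negP => /jmin; rewrite ltnn.
by apply: le_trans (term _ jn dj) _; rewrite lerDl.
Qed.

End riesz_lower.

Lemma limn_einf_lt (R : realType) (u : (\bar R)^nat) (M : \bar R) (m : nat) :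
  (limn_einf u < M)%E -> exists2 n, (m <= n)%N & (u n < M)%E.
Proof.
rewrite limn_einf_lim => uM.
have : (einfs u m < M)%E.
  apply: le_lt_trans uM; apply: lime_ge; first exact: is_cvg_einfs.
  exists m => // n /= mn; exact: nondecreasing_einfs.
by move=> /ereal_inf_lt[_ [n /= mn <-]]; exists n.
Qed.

(** * Comparison of [eta] with a projected law *)

Section density_cover.
Context {R : realType} {Y : pointedMetricType R}.
Hypothesis sepY : separable Y.
Variable eta : {measure set (g_sigma_algebraType (@open Y)) -> \bar R}.
Variables (kappa : R).

Lemma lower_density_gt (c : R) y : (c%:E < lower_density eta kappa y)%E ->
  exists2 r0, 0 < r0 & forall r, 0 < r -> r < r0 -> ((c * r `^ kappa)%:E <= eta (cball y r))%E.
Proof.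
rewrite /lower_density /limf_einf /= lteNr => /ereal_inf_lt[_ [A /= A0 <-]] supA.
have [r0 /= r00 r0A] := A0.
exists r0 => // r rgt0 rr0.
have Ar : A r.
  apply: r0A => //=.
  by rewrite sub0r normrN gtr0_norm.
have rk : 0 < r `^ kappa by exact: powR_gt0.
have : (c%:E < eta (cball y r) / (r `^ kappa)%:E)%E.
  rewrite -lteN2; apply: le_lt_trans supA.
  by apply: ereal_sup_ubound; exists r.
by rewrite inver gt_eqF// lte_pdivlMr// -EFinM => /ltW.
Qed.

Lemma measurable_cball y r : measurable (cball y r : set (g_sigma_algebraType (@open Y))).
Proof.
rewrite -[cball y r]setCK; apply: measurableC; apply: sub_sigma_algebra.
rewrite openE => z /= /negP; rewrite -ltNge => rz; rewrite /interior; apply/nbhs_ballP.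
exists (mdist y z - r) => /=; first by rewrite subr_gt0.
move=> w; rewrite ballEmdist /= => zw; apply/negP; rewrite -ltNge.
have := metric_triangle y w z; rewrite (metric_sym w z); lra.
Qed.

Variables (d : measure_display) (T : measurableType d) (Q : {measure set T -> \bar R}).
Variable g : T -> Y.
Hypothesis mg : forall y, measurable_fun setT (fun t => mdist y (g t)).

(** The lower kappa-density at [g t] of the image of [Q] under [g], along dyadic radii. *)
Definition dyadic_density (t : T) : \bar R :=
  limn_einf (fun n => (((2 `^ kappa) ^+ n)%:E * Q [set t' | (mdist (g t) (g t') <= rad n)%R])%E).

(** Around each point, a small ball of radius r has [eta] at least c r^kappa, and the ball eight
    times larger has projected mass at most M (8 r)^kappa. Disjoint small balls fit into [U] while
    the corresponding large ones cover [D]. The set [V] stands in for [D], whose measurability is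
    not known. *)
Lemma density_cover (c M : R) (U : set Y) (D : set T) : 0 < c -> 0 < M -> open U ->
  (forall t, D t -> [/\ U (g t), (c%:E < lower_density eta kappa (g t))%E &
     (dyadic_density t < M%:E)%E]) ->
  exists V, [/\ measurable V, D `<=` V & (Q V <= (M * 8 `^ kappa / c)%:E * eta U)%E].
Proof.
move=> c0 M0 oU DP.
have /choice[n nP] (t : T) : exists n, D t ->
    [/\ cball (g t) (rad n.+3) `<=` U,
       ((c * rad n.+3 `^ kappa)%:E <= eta (cball (g t) (rad n.+3)))%E &
       (Q [set t' | (mdist (g t) (g t') <= rad n)%R] <= (M * rad n `^ kappa)%:E)%E].
  have [Dt|] := pselect (D t); last by exists 0%N.
  have [Ut ct Mt] := DP t Dt.
  have [r0 r00 r0P] := lower_density_gt ct.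
  have /nbhs_ballP[r1 /= r10 r1U] : nbhs (g t) U by exact: open_nbhs_nbhs.
  have [m mr] := rad_small (e := Num.min r0 r1) ltac:(by rewrite lt_min r00 r10).
  (* The mass bound holds only at infinitely many scales, so its scale is chosen last, beyond the
     threshold after which the other two properties hold at every scale. *)
  have [n mn nM] := limn_einf_lt m Mt.
  have : rad n.+3 < Num.min r0 r1.
    by apply: le_lt_trans mr; apply: rad_le; rewrite (leq_trans mn)// -addn3 leq_addr.
  rewrite lt_min => /andP[nr0 nr1].
  exists n => _; split.
  - move=> z; rewrite /cball /= => zn; apply: r1U; rewrite ballEmdist /=.
    exact: le_lt_trans nr1.
  - by apply: r0P => //; exact: rad_gt0.
  - have k0 : 0 < (2 `^ kappa) ^+ n :> R by rewrite exprn_gt0// powR_gt0.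
    rewrite rad_powR powRN exprVn EFinM lee_pdivlMr//.
    by rewrite muleC; exact: ltW.
pose F t := cball (g t) (rad (n t).+3).
have F0 t : D t -> F t !=set0 by move=> _; exists (g t); rewrite /F /cball /= mdistxx rad_ge0.
have [W [WD tW] WP] := vitali_disjoint n F0.
have cW : countable W.
  apply: (trivIset_open_countable (F := fun t => [set z | mdist (g t) z < rad (R:=R) (n t).+3]) sepY).
    move=> t _; split; first exact: open_mdist_lt.
    by exists (g t); rewrite /= mdistxx rad_gt0.
  move=> t t' Wt Wt' [z [/= tz tz']]; apply: tW => //; exists z.
  by split; rewrite /F /cball /=; exact: ltW.
have /countable_injP[h hI] := cW.
have /choice[opt optP] (k : nat) : exists o : option T, forall t, o = Some t <-> W t /\ h t = k.
  have [[t [Wt ht]]|no] := pselect (exists t, W t /\ h t = k).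
    exists (Some t) => t'; split => [[<-]//|[Wt' ht']]; congr Some.
    by apply: hI; rewrite ?inE// ht ht'.
  by exists None => t; split => // -[Wt ht]; exfalso; apply: no; exists t.
pose FF k : set Y := if opt k is Some t then F t else set0.
pose B t := [set t' | mdist (g t) (g t') <= rad (n t)].
pose BB k : set T := if opt k is Some t then B t else set0.
have mB t : measurable (B t).
  have mcst z : measurable_fun setT (fun _ : T => mdist z (g t)) by exact: measurable_cst.
  exact/measurable_mdist_le/mg.
have mBB k : measurable (BB k) by rewrite /BB; case: (opt k).
have mFF k : measurable (FF k : set (g_sigma_algebraType (@open Y))).
  by rewrite /FF; case: (opt k) => [t|] //; exact: measurable_cball.
exists (\bigcup_k BB k); split; first exact: bigcup_measurable.
  move=> t Dt; have [w Ww [nwt [z [tz wz]]]] := WP t Dt.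
  exists (h w) => //; rewrite /BB (_ : opt (h w) = Some w); last exact/optP.
  rewrite /B /=; move: tz wz; rewrite /F /cball /= => tz wz.
  have := metric_triangle (g w) z (g t); rewrite (metric_sym z).
  have := rad_le (R := R) (nwt : ((n w).+3 <= (n t).+3)%N).
  have := radS (R := R) (n w); have := radS (R := R) (n w).+1; have := radS (R := R) (n w).+2.
  have := rad_gt0 (R := R) (n w).+3; move: tz wz; lra.
have K0 : 0 <= M * 8 `^ kappa / c by rewrite divr_ge0 ?mulr_ge0 ?powR_ge0// ltW.
apply: (@le_trans _ _ (\sum_(0 <= k <oo) Q (BB k))%E).
  by apply: measure_sigma_subadditive => //; exact: bigcup_measurable.
apply: (@le_trans _ _ (\sum_(0 <= k <oo) (M * 8 `^ kappa / c)%:E * eta (FF k))%E).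
  apply: lee_nneseries => // k _; rewrite /BB /FF; case ok : (opt k) => [t|]; last first.
    by rewrite !measure0 mule0.
  have [Wt _] := (optP k t).1 ok; have [_ etaF QB] := nP t (WD _ Wt).
  apply: le_trans QB _.
  apply: (@le_trans _ _ ((M * 8 `^ kappa / c)%:E * (c * rad (n t).+3 `^ kappa)%:E)%E).
    rewrite -EFinM lee_fin (_ : rad (n t) = 8 * rad (n t).+3); last first.
      by rewrite (radS (n t)) (radS (n t).+1) (radS (n t).+2); ring.
    rewrite powRM ?rad_ge0// le_eqVlt; apply/orP; left; apply/eqP.
    by field; rewrite gt_eqF.
  by apply: lee_wpmul2l => //; rewrite lee_fin.
rewrite nneseriesZl//; apply: lee_wpmul2l; first by rewrite lee_fin.
rewrite -measure_semi_bigcup//.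
- apply: le_measure; rewrite ?inE//.
  + exact: bigcup_measurable.
  + exact: sub_sigma_algebra.
  + move=> z [k _]; rewrite /FF; case ok : (opt k) => [t|//].
    by have [Wt _] := (optP k t).1 ok; have [FU _ _] := nP t (WD _ Wt); exact: FU.
- move=> k k' _ _ [z []]; rewrite /FF; case ok : (opt k) => [t|//]; case ok' : (opt k') => [t'|//].
  have [Wt <-] := (optP k t).1 ok; have [Wt' <-] := (optP k' t').1 ok'.
  by move=> tz tz'; congr h; apply: tW => //; exists z.
- exact: bigcup_measurable.
Qed.

End density_cover.

Section projections.
Context {R : realType} {Z : completeMetricType R}.
Hypothesis sepZ : separable Z.
Variables (X : set Z) (Y : pointedMetricType R).
Hypothesis sepY : separable Y.
Variables (d : measure_display) (L : measurableType d) (P : probability L R).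
Variables (proj : L -> X -> Y) (alpha kappa C : R).
Hypothesis mproj : jointly_measurable proj.
Hypotheses (alpha0 : 0 < alpha) (kappa0 : 0 < kappa) (C0 : 0 < C).
Hypothesis transversal : forall (delta : R) (x1 x2 : X), 0 < delta -> x1 <> x2 ->
  (P [set l | (mdist (proj l x1) (proj l x2)
              <= delta * mdist (set_val x1) (set_val x2) `^ alpha)%R]
   <= (C * delta `^ kappa)%:E)%E.
Variables (d' : measure_display) (T : measurableType d') (Q : probability T R).
Variables (xi : T -> X) (M : R).
Hypothesis mxi : forall z, measurable_fun setT (fun t => mdist z (set_val (xi t))).
Hypothesis energy : forall N, (\int[Q \x Q]_w
  (riesz (2 `^ (alpha * kappa)) N (set_val (xi w.1)) (set_val (xi w.2)))%:E <= M%:E)%E.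

Let a : R := 2 `^ (alpha * kappa).
Let a_gt0 : 0 < a. Proof. exact: powR_gt0. Qed.

Let close n : set (L * (T * T)) :=
  [set w | mdist (proj w.1 (xi w.2.1)) (proj w.1 (xi w.2.2)) <= rad n].

Let measurable_close n : measurable (close n).
Proof.
have mG := measurable_section sepZ mproj mxi.
apply: measurable_mdist_le; apply: (measurable_mdist2 point sepY) => y.
- apply: (measurableT_comp (f := fun w : L * T => mdist y (proj w.1 (xi w.2)))
    (g := fun w : L * (T * T) => (w.1, w.2.1)) (mG y)).
  apply: measurable_fun_pair; first exact: measurable_fst.
  exact: (measurableT_comp measurable_fst measurable_snd).
- apply: (measurableT_comp (f := fun w : L * T => mdist y (proj w.1 (xi w.2)))
    (g := fun w : L * (T * T) => (w.1, w.2.2)) (mG y)).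
  apply: measurable_fun_pair; first exact: measurable_fst.
  exact: (measurableT_comp measurable_snd measurable_snd).
Qed.

Let measurable_riesz N : measurable_fun setT
  (fun w : T * T => (riesz a N (set_val (xi w.1)) (set_val (xi w.2)))%:E).
Proof.
apply/measurable_EFinP; apply: measurable_sum => j.
apply: measurable_funM; first exact: measurable_cst.
apply: (measurableT_comp (f := bump j)); last first.
  apply: (measurable_mdist2 point sepZ) => z.
    exact: (measurableT_comp (mxi z) measurable_fst).
  exact: (measurableT_comp (mxi z) measurable_snd).
apply: measurable_maxr; first exact: measurable_cst.
apply: measurable_minr; first exact: measurable_cst.
by apply: measurable_funB; [exact: measurable_cst|apply: measurable_funM].
Qed.

Let indic_close n (w : L * (T * T)) : \bar R := (\1_(close n) w)%:E.

Let m_indic n : measurable_fun setT (indic_close n).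
Proof. by apply/measurable_EFinP; apply: measurable_indic. Qed.

Let close_section n w : (\int[P]_l indic_close n (l, w) =
  P [set l | (mdist (proj l (xi w.1)) (proj l (xi w.2)) <= rad n)%R])%E.
Proof.
have -> : (fun l => indic_close n (l, w)) = (fun l => (\1_(ysection (close n) w) l)%:E).
  by apply/funext => l; rewrite /indic_close !indicE mem_ysection.
rewrite integral_indic ?setIT//; last exact: measurable_ysection.
by congr (P _); apply/seteqP; split => l /=; rewrite /ysection/= in_setE.
Qed.

Let measurable_close_pair n (w : T * T) :
  measurable [set l | mdist (proj l (xi w.1)) (proj l (xi w.2)) <= rad n].
Proof.
rewrite (_ : [set l | _] = ysection (close n) w); first exact: measurable_ysection.
by apply/seteqP; split => l /=; rewrite /ysection/= in_setE.
Qed.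

(** Transversality with delta = 2^-n / d^alpha bounds the left side by C d^(-alpha kappa). For pairs
    below the truncation scale, a^2 (kernel + 1) is already at least 2^(kappa n) and a probability
    is at most 1; the factor C + 1 serves both cases. *)
Lemma prob_close_le n : exists N, forall w : T * T,
  (((2 `^ kappa) ^+ n)%:E *
    P [set l | (mdist (proj l (xi w.1)) (proj l (xi w.2)) <= rad n)%R] <=
   ((C + 1) * a ^+ 2)%:E * ((riesz a N (set_val (xi w.1)) (set_val (xi w.2)))%:E + 1))%E.
Proof.
have s0 : 0 < alpha * kappa by exact: mulr_gt0.
have [N NP] := @riesz_lower R Z _ s0 ((2 `^ kappa) ^+ n).
exists N => w; rewrite -EFinD -EFinM.
have K0 : 0 < (2 `^ kappa) ^+ n :> R by rewrite exprn_gt0// powR_gt0.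
set x1 := xi w.1; set x2 := xi w.2; set A := [set l | _].
have k1 : 0 <= a ^+ 2 * (riesz a N (set_val x1) (set_val x2) + 1).
  by rewrite mulr_ge0 ?exprn_ge0 ?(ltW a_gt0)// addr_ge0// riesz_ge0.
have [near|[dx0 far]] := NP (set_val x1) (set_val x2).
  apply: (@le_trans _ _ ((2 `^ kappa) ^+ n)%:E).
    rewrite -[leRHS]mule1; apply: lee_wpmul2l; first by rewrite lee_fin ltW.
    exact/probability_le1/measurable_close_pair.
  rewrite lee_fin; apply: le_trans near _; rewrite -[leRHS]mulrA.
  by apply: ler_peMl; [exact: k1|rewrite lerDr ltW].
set dx := mdist _ _ in dx0 far.
have neq : x1 <> x2 by move=> xx; move: dx0; rewrite /dx xx mdistxx ltxx.
have da : 0 < dx `^ alpha by exact: powR_gt0.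
have dl0 : 0 < rad n / dx `^ alpha by rewrite divr_gt0// rad_gt0.
have := transversal dl0 neq; rewrite -/dx divfK ?gt_eqF// => PA.
apply: (@le_trans _ _ (((2 `^ kappa) ^+ n)%:E * (C * (rad n / dx `^ alpha) `^ kappa)%:E)%E).
  by apply: lee_wpmul2l => //; rewrite lee_fin ltW.
rewrite -EFinM lee_fin.
have -> : (2 `^ kappa) ^+ n * (C * (rad n / dx `^ alpha) `^ kappa) = C * dx `^ (- (alpha * kappa)).
  rewrite powRM ?rad_ge0// ?invr_ge0 ?powR_ge0// rad_powR powRN exprVn.
  rewrite -[(dx `^ alpha)^-1]powRN -powRrM mulNr.
  by rewrite mulrCA mulVKf// gt_eqF.
apply: (@le_trans _ _ (C * (a ^+ 2 * (riesz a N (set_val x1) (set_val x2) + 1)))).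
  by rewrite ler_pM2l.
by rewrite -[leRHS]mulrA ler_wpM2r// lerDl.
Qed.

Let QQ : probability (T * T)%type R := (Q \x Q)%E.

Let K n : R := (2 `^ kappa) ^+ n.
Let K_gt0 n : 0 < K n. Proof. by rewrite exprn_gt0// powR_gt0. Qed.

Let self_energy n l := (\int[Q \x Q]_w indic_close n (l, w))%E.

Let m_self n : measurable_fun setT (self_energy n).
Proof.
have i0 w : (0 <= indic_close n w)%E by rewrite lee_fin.
exact: (@measurable_fun_fubini_tonelli_F _ _ _ _ _ QQ (indic_close n) (m_indic n) i0).
Qed.

(** A kappa-energy of the projected law: the normalized probability that two independent random
    points project to within 2^-n of each other, in the lower limit. *)
Definition limit_energy (l : L) : \bar R := limn_einf (fun n => ((K n)%:E * self_energy n l)%E).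

Lemma measurable_limit_energy : measurable_fun setT limit_energy.
Proof.
apply: measurable_fun_limn_einf => n; apply: emeasurable_funM; last exact: m_self.
exact: measurable_cst.
Qed.

Let self_ge0 n l : (0 <= (K n)%:E * self_energy n l)%E.
Proof.
rewrite mule_ge0 ?lee_fin ?(ltW (K_gt0 n))//; apply: integral_ge0 => w _.
by rewrite lee_fin.
Qed.

Lemma limit_energy_ge0 l : (0 <= limit_energy l)%E.
Proof.
rewrite /limit_energy limn_einf_lim; apply: lime_ge; first exact: is_cvg_einfs.
by apply: nearW => n; apply: le_ereal_inf_tmp => _ [k _ <-].
Qed.

(** After Fatou, Tonelli integrates over [l] first, where [prob_close_le] applies. Its truncation
    depends on [n], but the energy bound [M] does not depend on the truncation. *)
Lemma integral_limit_energy : (\int[P]_l limit_energy l < +oo)%E.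
Proof.
pose B := (((C + 1) * a ^+ 2)%:E * (M%:E + 1))%E.
apply: (@le_lt_trans _ _ B); last by rewrite /B -EFinD -EFinM ltry.
apply: (@le_trans _ _ (limn_einf (fun n => \int[P]_l ((K n)%:E * self_energy n l)%E)%E)).
  apply: fatou => // n; apply: emeasurable_funM; last exact: m_self.
  exact: measurable_cst.
apply: limn_einf_le => n.
have self0 l : (0 <= self_energy n l)%E by apply: integral_ge0 => w _; rewrite lee_fin.
rewrite (@ge0_integralZl_EFin _ _ _ P _ measurableT _ (fun l _ => self0 l) (m_self n) _ (ltW (K_gt0 n))).
rewrite (fubini_tonelli (m1 := P) (m2 := QQ) (indic_close n))//; last by move=> w; rewrite lee_fin.
have mG : measurable_fun setT (fun w => \int[P]_l indic_close n (l, w))%E.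
  apply: (measurable_fun_fubini_tonelli_G (m1 := P) (indic_close n)) => // w.
  by rewrite lee_fin.
have G0 w : (0 <= \int[P]_l indic_close n (l, w))%E.
  by apply: integral_ge0 => l _; rewrite lee_fin.
rewrite -ge0_integralZl_EFin ?(ltW (K_gt0 n))//.
have [N NP] := prob_close_le n.
have c0 : 0 <= (C + 1) * a ^+ 2 by rewrite mulr_ge0 ?exprn_ge0 ?(ltW a_gt0)// addr_ge0// ltW.
have kge0 (w : T * T) : (0 <= (riesz a N (set_val (xi w.1)) (set_val (xi w.2)))%:E)%E.
  by rewrite lee_fin riesz_ge0.
have mk1 : measurable_fun setT
    (fun w : T * T => (riesz a N (set_val (xi w.1)) (set_val (xi w.2)))%:E + 1)%E.
  by apply: emeasurable_funD.
apply: (@le_trans _ _ (\int[Q \x Q]_w (((C + 1) * a ^+ 2)%:E *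
    ((riesz a N (set_val (xi w.1)) (set_val (xi w.2)))%:E + 1)))%E).
  apply: ge0_le_integral => //.
  - by move=> w _; rewrite mule_ge0// lee_fin ltW.
  - by apply: emeasurable_funM.
  - by apply: emeasurable_funM.
  - by move=> w _; rewrite close_section; exact: NP.
rewrite ge0_integralZl_EFin//; last by move=> w _; rewrite adde_ge0.
apply: lee_wpmul2l; first by rewrite lee_fin.
rewrite ge0_integralD//; apply: leeD; first exact: energy.
by rewrite integral_cst// mul1e; exact: probability_le1.
Qed.

Let density_term l n (t : T) : \bar R :=
  ((K n)%:E * Q [set t' | (mdist (proj l (xi t)) (proj l (xi t')) <= rad n)%R])%E.

Let section n l t : (Q [set t' | (mdist (proj l (xi t)) (proj l (xi t')) <= rad n)%R] =
  \int[Q]_t' indic_close n (l, (t, t')))%E.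
Proof.
pose A : set (T * T) := [set w | mdist (proj l (xi w.1)) (proj l (xi w.2)) <= rad n].
have mA : measurable A.
  rewrite (_ : A = xsection (close n) l); first exact: measurable_xsection.
  by apply/seteqP; split => w; rewrite /xsection /= in_setE.
rewrite (_ : (fun t' => indic_close n (l, (t, t'))) = fun t' => (\1_(xsection A t) t')%:E).
  rewrite integral_indic ?setIT//; last exact: measurable_xsection.
  by congr (Q _); apply/seteqP; split => t'; rewrite /xsection /= in_setE.
apply/funext => t'; by rewrite /indic_close !indicE mem_xsection.
Qed.

Let m_close_at l n : measurable_fun setT (fun w : T * T => indic_close n (l, w)).
Proof. exact: (measurable_fun_pair2 l (m_indic n)). Qed.

Let m_section l n : measurable_fun setT (fun t => \int[Q]_t' indic_close n (l, (t, t')))%E.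
Proof.
apply: (measurable_fun_fubini_tonelli_F (m2 := Q) (fun w => indic_close n (l, w))) => // w.
by rewrite lee_fin.
Qed.

Let m_term l n : measurable_fun setT (density_term l n).
Proof.
apply: emeasurable_funM; first exact: measurable_cst.
rewrite (_ : (fun t => _) = (fun t => \int[Q]_t' indic_close n (l, (t, t')))%E).
  exact: m_section.
by apply/funext => t; exact: section.
Qed.

Let point_density l := dyadic_density kappa Q (fun t => proj l (xi t)).

Lemma measurable_point_density l : measurable_fun setT (point_density l).
Proof. by apply: (measurable_fun_limn_einf (f := density_term l)) => n; exact: m_term. Qed.

Lemma integral_density_le l : (\int[Q]_t point_density l t <= limit_energy l)%E.
Proof.
rewrite /limit_energy.
have selfE n : ((K n)%:E * self_energy n l = \int[Q]_t density_term l n t)%E.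
  rewrite /density_term; under eq_integral do rewrite section.
  rewrite ge0_integralZl_EFin ?(ltW (K_gt0 n))//.
  - congr (_ * _)%E; rewrite /self_energy.
    by rewrite (fubini_tonelli1 (fun w => indic_close n (l, w)))// => w; rewrite lee_fin.
  - by move=> t _; apply: integral_ge0 => t' _; rewrite lee_fin.
rewrite (_ : (fun n => _) = fun n => \int[Q]_t density_term l n t)%E; last exact/funext.
by apply: fatou => // n; exact: m_term.
Qed.

Lemma point_density_ge0 l t : (0 <= point_density l t)%E.
Proof.
rewrite /point_density /dyadic_density limn_einf_lim; apply: lime_ge; first exact: is_cvg_einfs.
apply: nearW => n; apply: le_ereal_inf_tmp => _ [k _ <-].
by rewrite mule_ge0// lee_fin ltW.
Qed.

(* Markov's inequality at level 2 r + 1. *)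
Lemma half_low_density l r : limit_energy l = r%:E ->
  ((1 / 2)%:E <= Q [set t | (point_density l t < (2 * r + 1)%:E)%E])%E.
Proof.
move=> lr; have r0 : 0 <= r by rewrite -lee_fin -lr; exact: limit_energy_ge0.
set M1 := 2 * r + 1; have M0 : 0 < M1 by rewrite /M1; lra.
pose H := [set t | (M1%:E <= point_density l t)%E].
have mH : measurable H.
  rewrite -[H]setTI; apply: emeasurable_fun_c_infty => //; exact: measurable_point_density.
have QH : (Q H <= (1/2)%:E)%E.
  have : (M1%:E * Q H <= r%:E)%E.
    rewrite -lr; apply: le_trans (integral_density_le l).
    rewrite -[Q H]/(Q H) -(setIT H) -integral_indic// -ge0_integralZl_EFin ?(ltW M0)//; last first.
      by apply/measurable_EFinP; exact: measurable_indic.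
    apply: ge0_le_integral => //.
    - by move=> t _; rewrite mule_ge0// lee_fin ltW.
    - by apply: emeasurable_funM => //; apply/measurable_EFinP; exact: measurable_indic.
    - exact: measurable_point_density.
    - move=> t _; rewrite indicE; have [/set_mem//|_] := boolP (t \in H).
        by rewrite mule1.
      by rewrite mule0; exact: point_density_ge0.
  have QHfin : Q H \is a fin_num by exact: fin_num_measure.
  rewrite -(fineK QHfin) -EFinM !lee_fin; move: (fine (Q H)) => x.
  by rewrite /M1; nra.
have -> : [set t | (point_density l t < M1%:E)%E] = ~` H.
  by apply/seteqP; split => t; rewrite /H /= ltNge => /negP.
rewrite probability_setC//.
have QHfin : Q H \is a fin_num by exact: fin_num_measure.
move: QH; rewrite -(fineK QHfin) -EFinB !lee_fin; lra.
Qed.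

Let mg l y : measurable_fun setT (fun t => mdist y (proj l (xi t))).
Proof.
have mG := measurable_section sepZ mproj mxi.
exact: (measurable_fun_pair2 l (mG y)).
Qed.

Variable eta : {measure set (g_sigma_algebraType (@open Y)) -> \bar R}.

Lemma open_cover_measure c r l (U : set Y) : 0 < c ->
  (forall y, (c%:E < lower_density eta kappa y)%E) -> limit_energy l = r%:E ->
  open U -> range (proj l) `<=` U ->
  ((2 * ((2 * r + 1) * 8 `^ kappa / c))^-1%:E <= eta U)%E.
Proof.
move=> c0 cdens lr oU UX; have half := half_low_density lr.
have r0 : 0 <= r by rewrite -lee_fin -lr; exact: limit_energy_ge0.
set M1 := 2 * r + 1 in half *; have M0 : 0 < M1 by rewrite /M1; lra.
have [t|V [mV DV QV]] := density_cover sepY (eta := eta) (kappa := kappa) (Q := Q) (mg l) c0 M0 oU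
    (D := [set t | (point_density l t < M1%:E)%E]).
  by move=> tM; split => //; apply: UX; exists (xi t).
set A := M1 * 8 `^ kappa / c in QV *.
have A0 : 0 < A by rewrite divr_gt0// mulr_gt0// powR_gt0.
have mD : measurable [set t | (point_density l t < M1%:E)%E].
  rewrite -[X in measurable X]setTI; apply: emeasurable_fun_infty_o => //.
  exact: measurable_point_density.
have : ((1/2)%:E <= A%:E * eta U)%E.
  by apply: le_trans half (le_trans _ QV); apply: le_measure; rewrite ?inE.
have : (0 <= eta U)%E by exact: measure_ge0.
case: (eta U) => [x| |] //; last by move=> *; rewrite leey.
rewrite -EFinM !lee_fin => x0 Ax; rewrite invfM ler_pdivrMr// mulrC.
by move: Ax; rewrite mulrC div1r.
Qed.

(** If the outer measure were 0, regularity would give open neighbourhoods of the range with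
    arbitrarily small [eta], and [density_cover] would make a set of probability at least 1/2
    negligible. *)
Lemma range_positive l r : regular_measure eta kappa -> limit_energy l = r%:E ->
  (0 < borel_outer eta (range (proj l)))%E.
Proof.
move=> [outer dens] lr; rewrite lt0e; apply/andP; split; last first.
  by apply: le_ereal_inf_tmp => _ [B _ <-]; exact: measure_ge0.
apply/eqP => h0; have half := half_low_density lr.
have r0 : 0 <= r by rewrite -lee_fin -lr; exact: limit_energy_ge0.
set M1 := 2 * r + 1 in half; have M0 : 0 < M1 by rewrite /M1; lra.
set D := [set t | (point_density l t < M1%:E)%E] in half.
have mD : measurable D.
  rewrite -[D]setTI; apply: emeasurable_fun_infty_o => //; exact: measurable_point_density.
(* The lower density of [eta] is positive without a uniform bound, so the points are sorted by a
   lower bound 1 / (k + 1). *)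
pose Dk k := D `&` [set t | (k.+1%:R^-1%:E < lower_density eta kappa (proj l (xi t)))%E].
have nDk k : Q.-negligible (Dk k).
  have c0 : 0 < k.+1%:R^-1 :> R by rewrite invr_gt0.
  set c : R := k.+1%:R^-1 in c0.
  have A0 : 0 < M1 * 8 `^ kappa / c by rewrite divr_gt0// mulr_gt0// powR_gt0.
  have /choice[V VP] (n : nat) : exists V, [/\ measurable V, Dk k `<=` V & (Q V <= (n.+1%:R^-1)%:E)%E].
    have e0 : 0 < n.+1%:R^-1 / (M1 * 8 `^ kappa / c) :> R by rewrite divr_gt0// invr_gt0.
    have : (borel_outer eta (range (proj l)) < (n.+1%:R^-1 / (M1 * 8 `^ kappa / c))%:E)%E.
      by rewrite h0 lte_fin.
    rewrite outer => /ereal_inf_lt[_ [U [oU UX] <-] etaU].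
    have [t|V [mV DV QV]] := density_cover sepY (eta := eta) (kappa := kappa) (Q := Q) (mg l) c0 M0 oU (D := Dk k).
      by move=> [Dt kt]; split => //; apply: UX; exists (xi t).
    exists V; split => //; apply: le_trans QV _; rewrite muleC -lee_pdivlMr//.
    by rewrite -EFinM ltW.
  exists (\bigcap_n V n); split.
  - by apply: bigcap_measurable => [|n _]; [exists 0%N|have [] := VP n].
  - apply/eqP; rewrite eq_le measure_ge0 andbT; apply/lee_addgt0Pr => e e0; rewrite add0e.
    have [n _ nP] : \forall n \near \oo, n.+1%:R^-1 < e.
      have /cvgrPdist_lt/(_ _ e0) := @cvg_harmonic R; apply: filterS => m.
      by rewrite /harmonic /= sub0r normrN ger0_norm.
    have [mV _ QV] := VP n; apply: le_trans (le_trans QV _); last by rewrite lee_fin; apply/ltW/nP => /=.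
    apply: le_measure; rewrite ?inE//.
      by apply: bigcap_measurable => [|m _]; [exists 0%N|have [] := VP m].
    by move=> t; apply.
  - by move=> t Dt n _; have [_ + _] := VP n; apply.
have nD : Q.-negligible D.
  apply: (@negligibleS _ _ _ Q (\bigcup_k Dk k)); last exact: negligible_bigcup.
  move=> t Dt; have := dens (proj l (xi t)).
  set y := lower_density _ _ _ => y0.
  suff [k ky] : exists k, (k.+1%:R^-1%:E < y)%E by exists k.
  case: y y0 => [x| |]//; last by exists 0%N; rewrite ltry.
  rewrite lte_fin => x0.
  have [n _ nP] : \forall n \near \oo, n.+1%:R^-1 < x.
    have /cvgrPdist_lt/(_ _ x0) := @cvg_harmonic R; apply: filterS => m.
    by rewrite /harmonic /= sub0r normrN ger0_norm.
  by exists n; rewrite lte_fin; exact: (nP n (leqnn n)).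
have : Q D = 0%E by apply/negligibleP.
by move: half => /[swap] ->; rewrite lee_fin; lra.
Qed.

End projections.

Theorem theorem1p2 (R : realType)
  (Z : completeMetricType R) (sepZ : separable Z)
  (X : set Z) (anaX : analytic R X)
  (Y : pointedMetricType R) (sepY : separable Y)
  (d : measure_display) (L : measurableType d) (P : probability L R)
  (proj : L -> X -> Y) (mproj : jointly_measurable proj)
  (alpha kappa C : R) (alpha0 : 0 < alpha) (kappa0 : 0 < kappa) (C0 : 0 < C)
  (transversal : forall (delta : R) (x1 x2 : X), 0 < delta -> x1 <> x2 ->
    (P [set l | (mdist (proj l x1) (proj l x2)
                <= delta * mdist (set_val x1) (set_val x2) `^ alpha)%R]
     <= (C * delta `^ kappa)%:E)%E)
  (dimX : ((alpha * kappa)%:E < hausdorff_dim X)%E)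
  (eta : {measure set (g_sigma_algebraType (@open Y)) -> \bar R}) :
  (regular_measure eta kappa ->
    {ae P, forall l, (0 < borel_outer eta (range (proj l)))%E}) /\
  (strongly_regular_measure eta kappa -> sigma_finite setT eta ->
    (upper_integral P (fun l => (borel_outer eta (range (proj l)))^-1) < +oo)%E).
Proof.
have ak0 : 0 < alpha * kappa by exact: mulr_gt0.
have [xi [M [mxi energy]]] := frostman sepZ anaX ak0 dimX.
pose J := limit_energy proj kappa (@unif01 R) xi.
have mJ : measurable_fun setT J := measurable_limit_energy sepZ sepY kappa mproj unif01 mxi.
have J0 l : (0 <= J l)%E := limit_energy_ge0 proj kappa unif01 xi l.
have iJ : (\int[P]_l J l < +oo)%E :=
  integral_limit_energy sepZ sepY mproj alpha0 kappa0 C0 transversal mxi energy.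
have Jpos l r : regular_measure eta kappa -> J l = r%:E ->
    (0 < borel_outer eta (range (proj l)))%E.
  by move=> reg lr; exact: (range_positive sepZ sepY mproj mxi reg lr).
have Jlow (c r : R) l (U : set Y) : 0 < c ->
    (forall y, (c%:E < lower_density eta kappa y)%E) -> J l = r%:E ->
    open U -> range (proj l) `<=` U ->
    ((2 * ((2 * r + 1) * 8 `^ kappa / c))^-1%:E <= eta U)%E.
  by move=> c0 cdens lr oU XU; exact: (open_cover_measure sepZ sepY mproj mxi c0 cdens lr oU XU).
clearbody J.
split.
  move=> reg.
  have JI : P.-integrable setT J.
    apply/integrableP; split => //.
    by under eq_integral do rewrite gee0_abs//.
  have := integrable_ae measurableT JI; apply: filterS => l Jl.
  by apply: (Jpos l (fine (J l)) reg); rewrite fineK//; exact: Jl.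
move=> [[outer _] [c c0 dens]] _.
(* The constant of [open_cover_measure] for c / 2: the lower density must lie strictly above the
   constant used there. *)
pose A : R := 2 * (8 `^ kappa / (c / 2)).
have A0 : 0 < A by rewrite mulr_gt0// divr_gt0 ?powR_gt0// divr_gt0.
pose G l := (A%:E * (2%:E * J l + 1))%E.
have mG : measurable_fun setT G.
  apply: emeasurable_funM => //; apply: emeasurable_funD => //.
  exact: emeasurable_funM.
have J20 l : (0 <= 2%:E * J l)%E by rewrite mule_ge0.
apply: (@le_lt_trans _ _ (\int[P]_l G l)%E); last first.
  rewrite ge0_integralZl_EFin ?(ltW A0)//; last 2 first.
  - by move=> l _; rewrite adde_ge0.
  - by apply: emeasurable_funD => //; exact: emeasurable_funM.
  rewrite ge0_integralD//; last exact: emeasurable_funM.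
  rewrite integral_cst// ge0_integralZl_EFin//.
  rewrite [X in (_ + X)%E](_ : _ = 1%E); last by rewrite mul1e; exact: probability_setT.
  rewrite lte_mul_pinfty ?lee_fin ?(ltW A0)// lte_add_pinfty ?ltry//.
  by rewrite lte_mul_pinfty// lee_fin.
apply: ereal_inf_lbound; exists G => //; split => // l; rewrite /G.
have h0 : (0 <= borel_outer eta (range (proj l)))%E.
  by apply: le_ereal_inf_tmp => _ [B _ <-]; exact: measure_ge0.
have [Jy|Jy] := eqVneq (J l) +oo%E.
  by rewrite Jy mulry gtr0_sg// mul1e addye// mulry gtr0_sg// mul1e leey.
have Jfin : J l \is a fin_num by rewrite ge0_fin_numE// lt_neqAle Jy leey.
have Jr : J l = (fine (J l))%:E by rewrite fineK.
set r := fine (J l) in Jr *.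
have r0 : 0 <= r by rewrite fine_ge0.
rewrite (_ : (A%:E * (2%:E * J l + 1))%E = (A * (2 * r + 1))%:E); last by rewrite Jr.
have B0 : 0 < A * (2 * r + 1) by rewrite mulr_gt0//; lra.
rewrite inve_ple ?inE ?lee_fin ?(ltW B0)// inver gt_eqF//.
rewrite outer; apply: le_ereal_inf_tmp => _ [U [oU UX] <-].
have c20 : 0 < c / 2 by rewrite divr_gt0.
have cdens y : ((c / 2)%:E < lower_density eta kappa y)%E.
  by apply: lt_le_trans (dens y); rewrite lte_fin; lra.
have := Jlow _ _ _ _ c20 cdens Jr oU UX.
by rewrite /A (_ : 2 * ((2 * r + 1) * 8 `^ kappa / (c / 2)) =
  2 * (8 `^ kappa / (c / 2)) * (2 * r + 1)); [|ring].
Qed.
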